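(* Let $\gamma>0$ and $\omega\in\mathbb{R}$. Then the minimization problem $$d_\gamma(\omega)=\inf\left\{S_{\omega,\gamma}(u): u\in W(\mathbb{R})\setminus\{0\},\ I_{\omega,\gamma}(u)=0\right\}$$ has a minimizer. In addition, the infimum is achieved at solutions $\varphi$ of the stationary equation $-\partial_x^2\varphi-\gamma\delta(x)\varphi+\omega\varphi-\varphi\,\mathrm{Log}|\varphi|^2=0$ in $W'(\mathbb{R})$. More precisely, the set of minimizers $$\mathcal{N}_{\omega,\gamma}=\left\{\varphi\in W(\mathbb{R}): S_{\omega,\gamma}(\varphi)=d_\gamma(\omega),\ I_{\omega,\gamma}(\varphi)=0\right\}$$ is given by $\mathcal{N}_{\omega,\gamma}=\{e^{i\theta}\phi_{\omega,\gamma}:\theta\in\mathbb{R}\}$, where $$\phi_{\omega,\gamma}(x)=e^{\frac{\omega+1}{2}}\,e^{-\frac12\left(|x|+\frac{\gamma}{2}\right)^2}.$$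
   Context: All functions of $x\in\mathbb{R}$ are complex-valued, $\mathrm{Log}$ is the natural logarithm, and $0\,\mathrm{Log}\,0=0$. $W(\mathbb{R})=\{u\in H^1(\mathbb{R}): |u|^2\mathrm{Log}|u|^2\in L^1(\mathbb{R})\}$. This is a reflexive Banach space $W(\mathbb{R})=H^1(\mathbb{R})\cap L^A(\mathbb{R})$ with norm $\|u\|_{W(\mathbb{R})}=\|u\|_{H^1}+\|u\|_{L^A}$, where $A(s)=-s^2\mathrm{Log}(s^2)$ for $0\le s\le e^{-3}$, $A(s)=3s^2+4e^{-3}s-e^{-6}$ for $s\ge e^{-3}$, $L^A(\mathbb{R})=\{u\in L^1_{loc}(\mathbb{R}): A(|u|)\in L^1(\mathbb{R})\}$ and $\|u\|_{L^A}=\inf\{k>0:\int_{\mathbb{R}}A(k^{-1}|u|)\,dx\le 1\}$. $W'(\mathbb{R})$ is its (real) dual. For $u\in W(\mathbb{R})$: $$S_{\omega,\gamma}(u)=\tfrac12\|\partial_xu\|_{L^2}^2+\tfrac{\omega+1}{2}\|u\|_{L^2}^2-\tfrac{\gamma}{2}|u(0)|^2-\tfrac12\int_{\mathbb{R}}|u|^2\mathrm{Log}|u|^2\,dx,$$ $$I_{\omega,\gamma}(u)=\|\partial_xu\|_{L^2}^2+\omega\|u\|_{L^2}^2-\gamma|u(0)|^2-\int_{\mathbb{R}}|u|^2\mathrm{Log}|u|^2\,dx.$$ The stationary equation in $W'(\mathbb{R})$ means: for all $h\in W(\mathbb{R})$, $\Re\left[\int\varphi'\overline{h'}\,dx+\omega\int\varphi\overline{h}\,dx-\int\varphi\,\mathrm{Log}|\varphi|^2\,\overline{h}\,dx\right]-\gamma\Re[\varphi(0)\overline{h(0)}]=0$.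 *)

(* Defs.v *)
From HB Require Import structures.
From mathcomp Require Import all_boot all_order all_algebra.
From mathcomp Require Import all_classical all_reals all_analysis.
From mathcomp Require Import complex.

Set Implicit Arguments.
Unset Strict Implicit.
Unset Printing Implicit Defensive.

Import Order.TTheory GRing.Theory Num.Theory.
Import numFieldNormedType.Exports.
Import ComplexField.Normc.

Local Open Scope classical_set_scope.
Local Open Scope ring_scope.
Local Open Scope complex_scope.

Section LogSchrodingerDelta.
Context {R : realType}.
Local Notation mu := (@lebesgue_measure R).

Implicit Types (u v h f : R -> R[i]) (psi : R -> R) (gamma omega theta x : R).

(* R[i] carries neither a topology nor a sigma-algebra in the library, so
   continuity, measurability and integration are taken componentwise. *)
Definition ccontinuous u :=
  continuous (fun x => complex.Re (u x)) /\
  continuous (fun x => complex.Im (u x)).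

Definition cmeasurable u :=
  measurable_fun [set: R] (fun x => complex.Re (u x)) /\
  measurable_fun [set: R] (fun x => complex.Im (u x)).

Definition cintegral f : R[i] :=
  (\int[mu]_x complex.Re (f x)) +i* (\int[mu]_x complex.Im (f x)).

Definition L2enorm u : \bar R := ('N[mu]_2%:E[EFin \o (fun x => normc (u x))])%E.
Definition L2norm u : R := fine (L2enorm u).
Definition L2 : set (R -> R[i]) :=
  [set u | cmeasurable u /\ (L2enorm u < +oo)%E].

Definition test_function psi :=
  (forall n x, derivable (derive1n n psi) x 1) /\
  compact (closure [set x | psi x != 0]).

Definition weak_derivative u v :=
  forall psi, test_function psi ->
    cintegral (fun x => u x * (derive1 psi x)%:C) =
    - cintegral (fun x => v x * (psi x)%:C).

Definition H1 : set (R -> R[i]) :=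
  [set u | L2 u /\ exists v, L2 v /\ weak_derivative u v].

(* A choice of the (a.e. unique) square-integrable weak derivative of u in H1;
   it is the zero function, by convention, when there is none. *)
Definition dx u : R -> R[i] :=
  xget (fun=> 0) [set v | L2 v /\ weak_derivative u v].

(* [ln 0 = 0] in the library, so [0 * ln 0 = 0] as required. *)
Definition sqlog u x : R := normc (u x) ^+ 2 * ln (normc (u x) ^+ 2).

(* Every class in H^1(R) has exactly one continuous representative; W consists
   of these representatives, so that the value u 0 is meaningful and equality in
   W is equality of functions. *)
Definition W : set (R -> R[i]) :=
  [set u | ccontinuous u /\ H1 u /\
           mu.-integrable [set: R] (EFin \o sqlog u)].

Definition action omega gamma u : R :=
  2^-1 * L2norm (dx u) ^+ 2 + (omega + 1) / 2 * L2norm u ^+ 2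
  - gamma / 2 * normc (u 0) ^+ 2 - 2^-1 * \int[mu]_x sqlog u x.

Definition nehari omega gamma u : R :=
  L2norm (dx u) ^+ 2 + omega * L2norm u ^+ 2
  - gamma * normc (u 0) ^+ 2 - \int[mu]_x sqlog u x.

Definition admissible omega gamma : set (R -> R[i]) :=
  [set u | W u /\ u <> (fun=> 0) /\ nehari omega gamma u = 0].

(* The infimum is taken in the extended reals, where it always exists. *)
Definition level gamma omega : \bar R :=
  ereal_inf [set (action omega gamma u)%:E | u in admissible omega gamma].

Definition minimizers omega gamma : set (R -> R[i]) :=
  [set u | W u /\ (action omega gamma u)%:E = level gamma omega /\
           nehari omega gamma u = 0].

Definition stationary omega gamma u :=
  forall h, W h ->
    complex.Re (cintegral (fun x => dx u x * (dx h x)^*)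
                + omega%:C * cintegral (fun x => u x * (h x)^*)
                - cintegral (fun x => u x * (ln (normc (u x) ^+ 2))%:C
                                      * (h x)^*))
    - gamma * complex.Re (u 0 * (h 0)^*) = 0.

Definition expi theta : R[i] := cos theta +i* sin theta.

Definition phi omega gamma x : R :=
  expR ((omega + 1) / 2) * expR (- 2^-1 * (`|x| + gamma / 2) ^+ 2).

End LogSchrodingerDelta.

(* Main.v *)
Require Import Defs.
From HB Require Import structures.
From mathcomp Require Import all_boot all_order all_algebra.
From mathcomp Require Import all_classical all_reals all_analysis.
From mathcomp Require Import measurable_realfun complex ring lra.

(** Since [action = nehari / 2 + mass / 2], minimizing on the Nehari manifold
    means minimizing the mass [m] of [w = |u|^2].  Let [F], [G] be the cumulative
    functions of [w] and [phi^2], let [c] be the quotient of the masses of [phi^2]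
    and [w], and let [T = G^-1 (c F)] be the monotone transport map, so that
    [T' phi(T)^2 = c w] on [{0 < F < m}].  With [V y = (|y| + gamma/2)^2] and
    [q x = T x + sg x * gamma/2], completing the square gives, pointwise,
      [|u'|^2 + (gamma/2) sg w' + (omega - ln c) w - w ln w + (T w)'
        = |u' + q u|^2 + w (T' - 1 - ln T') + w (V(T) - q^2) >= 0].
    Integrating (the [sg] term produces [- gamma w(0)], and [T w] vanishes at both
    ends) yields [m ln c <= nehari u].  So [nehari u = 0] forces the mass of [u]
    to be at least that of [phi]; in the equality case the three terms vanish,
    whence [T' = 1], [T x = x], [w = phi^2] and [u' = - q u], i.e.
    [u / phi] is a constant of modulus one. *)

Set Implicit Arguments.
Unset Strict Implicit.
Unset Printing Implicit Defensive.

Import Order.TTheory GRing.Theory Num.Theory.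
Import numFieldNormedType.Exports.
Import ComplexField.Normc.

Local Open Scope classical_set_scope.
Local Open Scope ring_scope.
Local Open Scope complex_scope.

(** * Locally absolutely continuous functions *)

(** The infimum is compared with an explicit competitor, so neither compactness of minimizing
    sequences nor a Lagrange multiplier enters: the stationary equation is checked on [phi] itself.
    The obstacle is that no moment of [w] is assumed finite and that [u] may vanish: [T] is
    meaningful only on {0 < F < m}, may be unbounded towards the ends of that set, and [T'] vanishes
    wherever [w] does. The pointwise identity is therefore integrated over intervals [[a n, b n]]
    cut at the mass levels m / (n+2)^4. There |T| is O(n) because [phi^2] has a finite fourth
    moment, and w is O(n^-2) because [w] and |u'|^2 are integrable; hence T w tends to 0. The
    amplitude of [phi] makes the constants match: ln (phi^2) = omega + 1 - V, and this 1 cancels the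
    -1 of T' - 1 - ln T'. Translations of [phi^2] are invisible to T' - 1 - ln T'; they are excluded
    by V(T) - q^2, which for x <> 0 is positive as soon as T x and x have opposite signs. *)

Section RealIntegral.
Context {R : realType}.
Local Notation mu := (@lebesgue_measure R).
Local Notation intR A f := (mu.-integrable A (EFin \o f)).
Implicit Types (f g : R -> R) (A B : set R) (a b x y : R).

Lemma intR_D A f g : measurable A -> intR A f -> intR A g ->
  intR A (fun x => f x + g x).
Proof. by move=> mA; exact: integrableD. Qed.

Lemma intR_B A f g : measurable A -> intR A f -> intR A g ->
  intR A (fun x => f x - g x).
Proof. by move=> mA; exact: integrableB. Qed.

Lemma intR_Z A (k : R) f : measurable A -> intR A f -> intR A (fun x => k * f x).
Proof. by move=> mA; exact: integrableZl. Qed.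

Lemma intR_S A B f : measurable A -> measurable B -> B `<=` A ->
  intR A f -> intR B f.
Proof. by move=> mA mB BA; apply: integrableS. Qed.

Lemma intR_measurable A f : intR A f -> measurable_fun A f.
Proof. by move=> /integrableP[/measurable_EFinP]. Qed.

Lemma intR_le A f g : measurable A -> measurable_fun A f ->
  (forall x, A x -> `|f x| <= g x) -> intR A g -> intR A f.
Proof.
move=> mA mf fg; apply: le_integrable => //; first exact/measurable_EFinP.
by move=> x Ax /=; rewrite lee_fin (le_trans (fg _ Ax))// ler_norm.
Qed.

Lemma intR_eq A f g : measurable A -> {in A, f =1 g} -> intR A f -> intR A g.
Proof. by move=> mA fg; apply: eq_integrable => // x xA /=; rewrite fg. Qed.

Lemma intR_norm A f : measurable A -> intR A f -> intR A (fun x => `|f x|).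
Proof. by move=> mA /integrable_norm. Qed.

Lemma continuous_intR f a b : continuous f -> intR `[a, b] f.
Proof.
move=> cf; apply: continuous_compact_integrable; first exact: segment_compact.
exact: continuous_subspaceT.
Qed.

Lemma intR_contM f g a b : continuous f -> intR `[a, b] g ->
  intR `[a, b] (fun x => f x * g x).
Proof.
move=> cf ig.
have [M [Mr HM]] : bounded_set (f @` `[a, b]%classic).
  apply: compact_bounded; apply: continuous_compact; last exact: segment_compact.
  exact: continuous_subspaceT.
have mf : measurable_fun `[a, b]%classic f.
  by apply: measurable_funTS; exact: continuous_measurable_fun.
apply: (@intR_le _ _ (fun x => (M + 1) * `|g x|)) => //.
- by apply: measurable_funM => //; exact: intR_measurable.
- move=> x abx; rewrite normrM ler_wpM2r//.
  by apply: (HM (M + 1)); [rewrite ltrDl|exists x].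
- by apply: intR_Z => //; exact: intR_norm.
Qed.

Lemma Rint_split f a b c : a <= b -> b <= c -> intR `[a, c] f ->
  \int[mu]_(x in `[a, c]) f x =
  \int[mu]_(x in `[a, b]) f x + \int[mu]_(x in `[b, c]) f x.
Proof.
move=> ab bc fi.
have := @Rintegral_itvB _ f (BLeft a) (BRight c) b fi.
rewrite !bnd_simp => /(_ ab bc) H.
have ibc : intR `]b, c] f.
  by apply: intR_S fi => //; apply: subset_itvr; rewrite bnd_simp.
by rewrite -[X in _ + X](Rintegral_itv_obnd_cbnd ibc) -H addrC subrK.
Qed.

Lemma Rint_point f a : \int[mu]_(x in `[a, a]) f x = 0.
Proof. by rewrite set_itv1 Rintegral_set1. Qed.

Lemma Rint_le_subset f A B : measurable A -> measurable B -> A `<=` B ->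
  intR B f -> (forall x, 0 <= f x) ->
  \int[mu]_(x in A) f x <= \int[mu]_(x in B) f x.
Proof.
move=> mA mB AB fi f0.
rewrite /Rintegral fine_le//.
- by apply: integrable_fin_num => //; exact: intR_S fi.
- exact: integrable_fin_num.
apply: ge0_subset_integral => //.
- by apply/measurable_EFinP; exact: intR_measurable.
by move=> x _; rewrite lee_fin.
Qed.

Lemma Rint_dominated_cvg (f_ : nat -> R -> R) f g :
  (forall n, measurable_fun setT (f_ n)) -> measurable_fun setT f ->
  (forall x, f_ n x @[n --> \oo] --> f x) ->
  intR setT g -> (forall n x, `|f_ n x| <= g x) ->
  \int[mu]_x f_ n x @[n --> \oo] --> \int[mu]_x f x.
Proof.
move=> mf_ mf f_f gi f_g.
have [| | |//| |fi _ fcvg] := @dominated_convergence _ _ _ mu setT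
  measurableT (fun n => EFin \o f_ n) (EFin \o f) (EFin \o g).
- move=> n; apply/measurable_EFinP. exact: (mf_ n).
- exact/measurable_EFinP.
- apply: aeW => x _; apply: cvg_EFin; [exact: nearW|exact: f_f].
- by apply: aeW => x n _; exact: f_g.
by apply: fine_cvg; rewrite fineK//; exact: integrable_fin_num.
Qed.

(** Coverage is asked only where [f] is nonzero: the intervals [[a n, b n]] of the transport
    argument exhaust {0 < F < m}, which is not known beforehand to be the whole line. *)
Lemma cvg_Rint_sets f (D : nat -> set R) : (forall n, measurable (D n)) ->
  intR setT f ->
  (forall x, f x != 0 -> \forall n \near \oo, D n x) ->
  \int[mu]_(x in D n) f x @[n --> \oo] --> \int[mu]_x f x.
Proof.
move=> mD fi HD.
under eq_fun do rewrite Rintegral_mkcond.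
have mf : measurable_fun setT f by exact: intR_measurable.
apply: (@Rint_dominated_cvg _ _ (fun x => `|f x|)) => //.
- move=> n; apply/(measurable_restrictT _ _).1 => //.
  exact: measurable_funTS.
- move=> x; apply: cvg_near_cst.
  have [fx0|fx0] := eqVneq (f x) 0.
    apply: nearW => n; rewrite patchE; case: ifPn => //= _.
  by apply: filterS (HD _ fx0) => n Dnx; rewrite patchE mem_set.
- exact: intR_norm.
- move=> n x; rewrite patchE; case: ifPn => //= _.
  by rewrite normr0.
Qed.

(* Local absolute continuity of [f], with [g] as derivative. *)
Definition primitive f g := forall x y, x <= y ->
  intR `[x, y] g /\ f y - f x = \int[mu]_(t in `[x, y]) g t.

Lemma primitive_continuous f g : primitive f g -> continuous f.
Proof.
move=> fg x.
have ab : x - 1 <= x + 1 by lra.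
have [gi _] := fg _ _ ab.
have := @parameterized_integral_continuous _ _ _ g ab gi.
have -> : {within `[x - 1, x + 1], continuous
   (fun y => parameterized_integral mu (x - 1) y g)} =
   {within `[x - 1, x + 1], continuous (fun y => f y - f (x - 1))}.
  rewrite propeqE; split; apply: subspace_eq_continuous => y;
  by rewrite inE/= in_itv/= => /andP[h1 h2]; have [_ ] := fg _ _ h1.
move=> /continuous_within_itvP.
have lt : x - 1 < x + 1 by lra.
move=> /(_ lt)[+ _ _].
move=> /(_ x); rewrite in_itv/= => /(_ ltac:(apply/andP; split; lra)) H.
rewrite -[f](_ : (fun y => (f y - f (x-1)) + f (x-1)) = f); last first.
  by apply/funext => y; rewrite subrK.
by apply: cvgD => //; exact: cvg_cst.
Qed.

Lemma primitive_D f f' g g' : primitive f f' -> primitive g g' ->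
  primitive (fun x => f x + g x) (fun x => f' x + g' x).
Proof.
move=> hf hg x y xy; have [fi fe] := hf _ _ xy; have [gi ge] := hg _ _ xy.
split; first exact: intR_D.
by rewrite RintegralD// -fe -ge; ring.
Qed.

Lemma primitive_Z k f f' : primitive f f' ->
  primitive (fun x => k * f x) (fun x => k * f' x).
Proof.
move=> hf x y xy; have [fi fe] := hf _ _ xy.
by split; [exact: intR_Z|rewrite RintegralZl// -fe; ring].
Qed.

(* Real induction along [[x, y]]: an estimate with an additive right-hand side
   that holds on small intervals around each point holds globally. *)
Lemma local_additive_bound (h H : R -> R) x y : x <= y ->
  (forall t, x <= t <= y -> exists2 d, 0 < d &
     forall s r, t - d < s -> s <= t -> t <= r -> r < t + d -> x <= s -> r <= y ->
       `|h r - h s| <= H r - H s) ->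
  `|h y - h x| <= H y - H x.
Proof.
move=> xy loc.
pose S := [set t | x <= t <= y /\ `|h t - h x| <= H t - H x].
have Sx : S x by split; [rewrite lexx|rewrite !subrr normr0].
have hS : has_sup S.
  split; first by exists x.
  by exists y => t [/andP[]].
set t := sup S.
have xt : x <= t by apply: sup_ubound => //; exact: hS.2.
have ty : t <= y by apply: ge_sup; [exists x|move=> s [/andP[]]].
have [|d d0 Hd] := loc t; first by rewrite xt.
have [s Ss ts] := sup_adherent d0 hS; rewrite -/t in ts.
have st : s <= t by apply: sup_ubound => //; exact: hS.2.
have [/andP[xs sy] hs] := Ss.
pose r := Num.min y (t + d / 2).
have tr : t <= r by rewrite /r le_min ty/=; lra.
have rd : r < t + d by rewrite /r gt_min; apply/orP; right; lra.
have ry : r <= y by rewrite /r ge_min lexx.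
have hr := Hd s r ts st tr rd xs ry.
have Sr : S r.
  split; first by rewrite ry andbT (le_trans xt).
  have -> : h r - h x = (h r - h s) + (h s - h x) by ring.
  by apply: (le_trans (ler_normD _ _)); lra.
have rt : r <= t by apply: sup_ubound => //; exact: hS.2.
have : r = y.
  move: rt; rewrite /r; case: (leP y (t + d / 2)) => // _; lra.
by move=> <-; exact: Sr.2.
Qed.

(** On a short interval [[s, r]] the defect of the product rule is the integral of f' (g r - g z) +
    g' (f s - f z), which continuity bounds by a small multiple of the integral of |f'| + |g'|. This
    bound is additive, so [local_additive_bound] carries it to [[x, y]], and the multiple is
    arbitrary. *)
Lemma primitive_M f f' g g' : primitive f f' -> primitive g g' ->
  primitive (fun x => f x * g x) (fun x => f' x * g x + f x * g' x).
Proof.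
move=> pf pg.
have cf := primitive_continuous pf; have cg := primitive_continuous pg.
have i1 a b : a <= b -> intR `[a, b] (fun x => f' x * g x).
  move=> ab; apply: (@intR_eq _ (fun x => g x * f' x)) => //.
    by move=> x _; rewrite mulrC.
  by apply: intR_contM => //; exact: (pf _ _ ab).1.
have i2 a b : a <= b -> intR `[a, b] (fun x => f x * g' x).
  by move=> ab; apply: intR_contM => //; exact: (pg _ _ ab).1.
have i3 a b : a <= b -> intR `[a, b] (fun x => `|f' x| + `|g' x|).
  move=> ab; apply: intR_D => //; apply: intR_norm => //.
    exact: (pf _ _ ab).1.
  exact: (pg _ _ ab).1.
move=> x y xy.
have i12 a b : a <= b -> intR `[a, b] (fun x => f' x * g x + f x * g' x).
  by move=> ab; apply: intR_D => //; [exact: i1|exact: i2].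
split; first exact: i12.
apply/eqP; rewrite -subr_eq0 -normr_le0.
pose K := \int[mu]_(t in `[x, y]) (`|f' t| + `|g' t|).
have K0 : 0 <= K by apply: Rintegral_ge0 => t _; rewrite addr_ge0.
apply/ler_addgt0Pr => e e0; rewrite add0r.
have e'0 : 0 < e / (K + 1) by rewrite divr_gt0// ltr_wpDl.
pose P t := \int[mu]_(s in `[x, t]) (f' s * g s + f s * g' s).
pose Q t := \int[mu]_(s in `[x, t]) (`|f' s| + `|g' s|).
have := @local_additive_bound (fun t => f t * g t - P t)
  (fun t => e / (K + 1) * Q t) x y xy.
rewrite /P /Q !Rint_point -/K.
have -> : f y * g y - \int[mu]_(s in `[x, y]) (f' s * g s + f s * g' s) -
  (f x * g x - 0) = f y * g y - f x * g x -
   \int[mu]_(s in `[x, y]) (f' s * g s + f s * g' s) by ring.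
move=> H; apply: le_trans (H _) _; last first.
  rewrite mulr0 subr0 -mulrA ler_piMr// ?(ltW e0)//.
  rewrite mulrC ler_pdivrMr ?ltr_wpDl//; lra.
move=> t /andP[xt ty].
have [d d0 Hd] : exists2 d, 0 < d & forall s, `|t - s| < d ->
    `|f t - f s| < e / (K + 1) / 2 /\ `|g t - g s| < e / (K + 1) / 2.
  have e2 : 0 < e / (K + 1) / 2 by rewrite divr_gt0.
  have /cvgrPdist_lt/(_ _ e2) Hf := cf t.
  have /cvgrPdist_lt/(_ _ e2) Hg := cg t.
  have : nbhs t [set s | `|f t - f s| < e / (K + 1) / 2 /\
                         `|g t - g s| < e / (K + 1) / 2] by exact: filterI.
  move=> /(nbhs_ballP _ _).1[d /= d0 Hd].
  by exists d => // s ts; exact: Hd.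
exists d => // s r s1 s2 r1 r2 xs ry.
have sr : s <= r := le_trans s2 r1.
have xr : x <= r := le_trans xs sr.
have := Rint_split xs sr (i12 _ _ xr) => ->.
have := Rint_split xs sr (i3 _ _ xr) => ->.
have [ifr efr] := pf _ _ sr; have [igr egr] := pg _ _ sr.
set A := \int[mu]_(_ in `[x, s]) _; set B := \int[mu]_(_ in `[s, r]) _.
set A' := \int[mu]_(_ in `[x, s]) _; set B' := \int[mu]_(_ in `[s, r]) _.
have -> : f r * g r - (A + B) - (f s * g s - A) = f r * g r - f s * g s - B by ring.
have -> : e / (K + 1) * (A' + B') - e / (K + 1) * A' = e / (K + 1) * B' by ring.
(* The discrete product rule is exact with [g] frozen at [r] and [f] frozen at [s]. *)
have -> : f r * g r - f s * g s = g r * (f r - f s) + f s * (g r - g s) by ring.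
have -> : g r * (f r - f s) + f s * (g r - g s) =
    \int[mu]_(z in `[s, r]) (g r * f' z + f s * g' z).
  by rewrite RintegralD//; [rewrite !RintegralZl// efr egr|exact: intR_Z..].
have i4 : intR `[s, r] (fun z => g r * f' z + f s * g' z).
  by apply: intR_D => //; exact: intR_Z.
rewrite /B -RintegralB//; last exact: i12.
rewrite /B' -RintegralZl//; last exact: i3.
apply: le_trans (le_normr_Rintegral _ _) _ => //.
  by apply: intR_B => //; exact: i12.
apply: le_Rintegral => //.
- by apply: intR_norm => //; apply: intR_B => //; exact: i12.
- by apply: intR_Z => //; exact: i3.
move=> z /=; rewrite in_itv/= => /andP[sz zr].
have -> : g r * f' z + f s * g' z - (f' z * g z + f z * g' z) =
  f' z * ((g t - g z) - (g t - g r)) + g' z * ((f t - f z) - (f t - f s)) by ring.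
have hz : `|t - z| < d by clear -s1 s2 r1 r2 sz zr; rewrite ltr_norml; apply/andP; split; lra.
have hr : `|t - r| < d by clear -s1 s2 r1 r2 sz zr; rewrite ltr_norml; apply/andP; split; lra.
have hs : `|t - s| < d by clear -s1 s2 r1 r2 sz zr; rewrite ltr_norml; apply/andP; split; lra.
have [fz gz] := Hd _ hz; have [_ gr] := Hd _ hr; have [fs _] := Hd _ hs.
apply: (le_trans (ler_normD _ _)); rewrite !normrM mulrDr.
have n1 := ler_normB (g t - g z) (g t - g r).
have n2 := ler_normB (f t - f z) (f t - f s).
by apply: lerD; rewrite mulrC ler_wpM2r//; clear -fz gz gr fs n1 n2; lra.
Qed.

End RealIntegral.

(** * Absolutely continuous functions on the whole line: gluing, decay at infinity, uniqueness of
    the derivative *)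

Section RealIntegral2.
Context {R : realType}.
Local Notation mu := (@lebesgue_measure R).
Local Notation intR A f := (mu.-integrable A (EFin \o f)).
Implicit Types (f g : R -> R) (A B : set R) (a b x y : R).

Lemma ae_imp (P Q : R -> Prop) : (forall x, P x -> Q x) ->
  {ae mu, forall x, P x} -> {ae mu, forall x, Q x}.
Proof. by move=> PQ; exact: (@filterS _ _ (ae_filter_ringOfSetsType mu) _ _ PQ). Qed.

Lemma ae_and (P Q : R -> Prop) : {ae mu, forall x, P x} ->
  {ae mu, forall x, Q x} -> {ae mu, forall x, P x /\ Q x}.
Proof. by move=> HP HQ; exact: (@filterI _ _ (ae_filter_ringOfSetsType mu)). Qed.

Lemma intR_patch A f : measurable A -> intR setT f -> intR setT (f \_ A).
Proof.
move=> mA fi; have mf := intR_measurable fi.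
apply: (@intR_le _ _ _ (fun x => `|f x|)) => //; last exact: intR_norm.
  by apply/(measurable_restrictT _ _).1 => //; exact: measurable_funTS.
by move=> x _; rewrite patchE; case: ifPn => //= _; rewrite normr0.
Qed.

Lemma intR_open_eq f g x y : (forall z, x < z < y -> f z = g z) ->
  intR `[x, y] f ->
  intR `[x, y] g /\ \int[mu]_(z in `[x, y]) g z = \int[mu]_(z in `[x, y]) f z.
Proof.
move=> fg fi.
have e z : z \in `]x, y[%classic -> f z = g z.
  by rewrite inE/= in_itv/=; exact: fg.
have sub : `]x, y[ `<=` `[x, y]%classic.
  by apply: subset_itv; rewrite bnd_simp.
have fio : intR `]x, y[ f by apply: intR_S fi.
have gio : intR `]x, y[ g by apply: intR_eq fio.
have mfo := intR_measurable fio; have mgo := intR_measurable gio.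
split.
  apply/integrableP; split.
    by apply/measurable_EFinP; exact: measurable_fun_itv_cc mgo.
  rewrite integral_itv_bndoo; first by case/integrableP : gio.
  by apply: measurableT_comp => //; exact/measurable_EFinP.
rewrite /Rintegral (@integral_itv_bndoo _ x y (EFin \o g) true false); last first.
  exact/measurable_EFinP.
rewrite (@integral_itv_bndoo _ x y (EFin \o f) true false); last first.
  exact/measurable_EFinP.
by congr fine; apply: eq_integral => z ze /=; rewrite e.
Qed.

Lemma Rint_ae_eq A f g : measurable A -> measurable_fun A f ->
  measurable_fun A g -> {ae mu, forall x, A x -> f x = g x} ->
  \int[mu]_(x in A) f x = \int[mu]_(x in A) g x.
Proof.
move=> mA mf mg fg; congr fine; apply: ae_eq_integral => //.
- exact/measurable_EFinP.
- exact/measurable_EFinP.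
by apply: ae_imp fg => x h Ax; rewrite h.
Qed.

Lemma derive_primitive f f' : (forall x, is_derive x 1 f (f' x)) ->
  continuous f' -> primitive f f'.
Proof.
move=> df cf' x y xy; split; first exact: continuous_intR.
have [->|xney] := eqVneq x y; first by rewrite Rint_point subrr.
have lxy : x < y by rewrite lt_neqAle xney.
have cf : continuous f.
  by move=> z; apply: differentiable_continuous; apply/derivable1_diffP;
     exact: (@ex_derive _ _ _ _ _ _ _ (df z)).
rewrite /Rintegral (@continuous_FTC2 _ f' f)//.
- exact: continuous_subspaceT.
- split; first by move=> z _; exact: (@ex_derive _ _ _ _ _ _ _ (df z)).
  + exact/cvg_at_right_filter/cf.
  + exact/cvg_at_left_filter/cf.
- by move=> z _; rewrite derive1E (@derive_val _ _ _ _ _ _ _ (df z)).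
Qed.

(** Nothing is asked of [g] at 0, so derivatives with a jump there, such as that of a function of
    |x|, are covered; continuity at 0 is hidden in the two non-strict conditions on [f]. *)
Lemma primitive_glue0 f g f1 g1 f2 g2 : primitive f1 g1 -> primitive f2 g2 ->
  (forall x, x <= 0 -> f x = f1 x) -> (forall x, 0 <= x -> f x = f2 x) ->
  (forall x, x < 0 -> g x = g1 x) -> (forall x, 0 < x -> g x = g2 x) ->
  primitive f g.
Proof.
move=> p1 p2 e1 e2 h1 h2.
have N x y : x <= y -> y <= 0 ->
    intR `[x, y] g /\ f y - f x = \int[mu]_(t in `[x, y]) g t.
  move=> xy y0; have [i1 v1] := p1 _ _ xy.
  have [|i v] := @intR_open_eq g1 g x y _ i1.
    by move=> z /andP[_ zy]; rewrite h1// (lt_le_trans zy).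
  by split=> //; rewrite v -v1 !e1// (le_trans xy).
have P x y : x <= y -> 0 <= x ->
    intR `[x, y] g /\ f y - f x = \int[mu]_(t in `[x, y]) g t.
  move=> xy x0; have [i1 v1] := p2 _ _ xy.
  have [|i v] := @intR_open_eq g2 g x y _ i1.
    by move=> z /andP[zx _]; rewrite h2// (le_lt_trans x0).
  by split=> //; rewrite v -v1 !e2// (le_trans x0).
move=> x y xy.
have [y0|/ltW y0] := leP y 0; first exact: N.
have [x0|/ltW x0] := leP 0 x; first exact: P.
have [iN vN] := N _ _ x0 (lexx _); have [iP vP] := P _ _ y0 (lexx _).
have i : intR `[x, y] g.
  apply/integrableP; split.
    rewrite (@itv_bndbnd_setU _ _ _ (BRight 0)) ?bnd_simp//.
    apply/measurable_funU => //; split; apply/measurable_EFinP.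
      exact: intR_measurable.
    by apply: measurable_funS (intR_measurable iP) => //; apply: subset_itvr; rewrite bnd_simp.
  rewrite (@itv_bndbnd_setU _ _ _ (BRight 0)) ?bnd_simp//.
  rewrite ge0_integral_setU//=.
  - rewrite lte_add_pinfty//; first by case/integrableP : iN.
    have : intR `]0, y] g.
      by apply: intR_S iP => //; apply: subset_itvr; rewrite bnd_simp.
    by case/integrableP.
  - apply/measurable_EFinP; apply: measurableT_comp => //.
    apply/measurable_funU => //; split; first exact: intR_measurable.
    by apply: measurable_funS (intR_measurable iP) => //; apply: subset_itvr; rewrite bnd_simp.
  - apply/disj_setPS => z [/=]; rewrite !in_itv/= => /andP[_ z0] /andP[].
    by rewrite ltNge z0.
split=> //; rewrite (Rint_split x0 y0 i) -vN -vP; ring.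
Qed.

Lemma Rint_itv_cvg0 f (s : nat -> R) : intR setT f ->
  (forall x, \forall n \near \oo, ~ (s n <= x <= s n + 1)) ->
  \int[mu]_(x in `[s n, s n + 1]) f x @[n --> \oo] --> 0.
Proof.
move=> fi hs.
under eq_fun do rewrite Rintegral_mkcond.
have mf := intR_measurable fi.
have -> : 0 = \int[mu]_x (cst 0 x) :> R.
  by rewrite /Rintegral integral0.
apply: (@Rint_dominated_cvg _ _ _ (fun x => `|f x|)) => //.
- move=> n; apply/(measurable_restrictT _ _).1 => //.
  exact: measurable_funTS.
- move=> x; apply: cvg_near_cst; apply: filterS (hs x) => n h.
  by rewrite patchE memNset//= in_itv.
- exact: intR_norm.
- by move=> n x; rewrite patchE; case: ifPn => //= _; rewrite normr0.
Qed.

(** For every x in the unit window I starting at s n, |f (s n)| is at most |f x| plus the integral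
    of |g| over I. Averaging over x in I, of measure one, leaves two integrals over a window that
    escapes every point. *)
Lemma primitive_cvg0 f g (s : nat -> R) : primitive f g ->
  intR setT f -> intR setT g ->
  (forall x, \forall n \near \oo, ~ (s n <= x <= s n + 1)) ->
  f (s n) @[n --> \oo] --> 0.
Proof.
move=> pfg fi gi hs.
have a0 := Rint_itv_cvg0 (intR_norm measurableT fi) hs.
have b0 := Rint_itv_cvg0 (intR_norm measurableT gi) hs.
apply/norm_cvg0P.
apply: (@squeeze_cvgr _ _ _ _ (cst 0) (fun n => \int[mu]_(x in `[s n, s n + 1]) `|f x| +
    \int[mu]_(x in `[s n, s n + 1]) `|g x|)); last 2 first.
- exact: cvg_cst.
- by rewrite -[X in _ --> X](addr0 0); exact: cvgD.
apply: nearW => n /=; rewrite normr_ge0/=.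
set I := `[s n, s n + 1]%classic.
have mI : measurable I by exact: measurable_itv.
have fI : intR I (fun x => `|f x|) by apply: intR_norm => //; exact: intR_S fi.
have gI : intR I (fun x => `|g x|) by apply: intR_norm => //; exact: intR_S gi.
pose B := \int[mu]_(x in I) `|g x|.
have mu1 r : \int[mu]_(_ in I) r = r.
  have m1 : fine (mu I) = 1.
    by rewrite /I lebesgue_measure_itv/= lte_fin ltrDl ltr01/= addrAC subrr add0r.
  by rewrite Rintegral_cst// -[RHS]mulr1; congr (_ * _).
have iB r : intR I (fun _ : R => r).
  by apply: continuous_intR => x; exact: cvg_cst.
rewrite -[leLHS]mu1 -/B -[X in _ <= _ + X]mu1 -RintegralD//.
apply: le_Rintegral => //; first exact: intR_D.
move=> x /=; rewrite /I/= in_itv/= => /andP[sx xs].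
have [_ e] := pfg _ _ sx.
have -> : f (s n) = f x - (f x - f (s n)) by ring.
apply: (le_trans (ler_normB _ _)); rewrite lerD2l e.
have sI : `[s n, x] `<=` I.
  by apply: subset_itvl; rewrite bnd_simp.
apply: le_trans (le_normr_Rintegral _ _) _ => //; first exact: intR_S gi.
exact: Rint_le_subset.
Qed.

Lemma shift_out x : forall z, \forall n \near \oo, ~ (x + n%:R <= z <= x + n%:R + 1).
Proof.
move=> z; near=> n => /andP[h _].
have : z - x < n%:R by near: n; exact: nbhs_infty_gtr.
lra.
Unshelve. all: by end_near. Qed.

Lemma shiftN_out x : forall z, \forall n \near \oo, ~ (x - n%:R <= z <= x - n%:R + 1).
Proof.
move=> z; near=> n => /andP[_ h].
have : x + 1 - z < n%:R by near: n; exact: nbhs_infty_gtr.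
lra.
Unshelve. all: by end_near. Qed.

Lemma primitive_tail_right f g x : primitive f g ->
  intR setT f -> intR setT g -> \int[mu]_(t in `[x, +oo[) g t = - f x.
Proof.
move=> pfg fi gi.
have c1 : f (x + n%:R) @[n --> \oo] --> 0.
  by apply: primitive_cvg0 pfg _ _ _ => //; exact: shift_out.
have gx : intR setT (g \_ `[x, +oo[).
  exact: intR_patch.
have := @cvg_Rint_sets _ (g \_ `[x, +oo[) (fun n => `[x, x + n%:R]%classic)
  (fun n => measurable_itv _) gx.
rewrite -Rintegral_mkcond.
have H : forall z, (g \_ `[x, +oo[) z != 0 -> \forall n \near \oo, `[x, x + n%:R]%classic z.
  move=> z; rewrite patchE; case: ifPn; last by rewrite eqxx.
  rewrite inE/= in_itv/= andbT => xz _.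
  near=> n; rewrite /= in_itv/= xz/= -lerBlDl.
  by near: n; exact: nbhs_infty_ger.
move=> /(_ H).
have -> : (fun n => \int[mu]_(z in `[x, x + n%:R]) (g \_ `[x, +oo[) z) =
          (fun n => f (x + n%:R) - f x).
  apply/funext => n; have h : x <= x + n%:R by rewrite lerDl.
  rewrite (pfg _ _ h).2; apply: eq_Rintegral => z; rewrite inE/= in_itv/= => /andP[xz _].
  by rewrite patchE mem_set//= in_itv/= xz.
move=> c2; have c3 : f (x + n%:R) - f x @[n --> \oo] --> 0 - f x.
  by apply: cvgB => //; exact: cvg_cst.
by rewrite sub0r in c3; exact: cvg_unique c2 c3.
Unshelve. all: by end_near. Qed.

Lemma primitive_tail_left f g x : primitive f g ->
  intR setT f -> intR setT g -> \int[mu]_(t in `]-oo, x]) g t = f x.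
Proof.
move=> pfg fi gi.
have c1 : f (x - n%:R) @[n --> \oo] --> 0.
  by apply: primitive_cvg0 pfg _ _ _ => //; exact: shiftN_out.
have gx : intR setT (g \_ `]-oo, x]).
  exact: intR_patch.
have := @cvg_Rint_sets _ (g \_ `]-oo, x]) (fun n => `[x - n%:R, x]%classic)
  (fun n => measurable_itv _) gx.
rewrite -Rintegral_mkcond.
have H : forall z, (g \_ `]-oo, x]) z != 0 -> \forall n \near \oo, `[x - n%:R, x]%classic z.
  move=> z; rewrite patchE; case: ifPn; last by rewrite eqxx.
  rewrite inE/= in_itv/= => xz _.
  near=> n; rewrite /= in_itv/= xz andbT lerBlDr -lerBlDl.
  by near: n; exact: nbhs_infty_ger.
move=> /(_ H).
have -> : (fun n => \int[mu]_(z in `[x - n%:R, x]) (g \_ `]-oo, x]) z) =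
          (fun n => f x - f (x - n%:R)).
  apply/funext => n; have h : x - n%:R <= x by rewrite gerBl.
  rewrite (pfg _ _ h).2; apply: eq_Rintegral => z; rewrite inE/= in_itv/= => /andP[_ xz].
  by rewrite patchE mem_set//= in_itv/= xz.
move=> c2; have c3 : f x - f (x - n%:R) @[n --> \oo] --> f x - 0.
  by apply: cvgB => //; exact: cvg_cst.
by rewrite subr0 in c3; exact: cvg_unique c2 c3.
Unshelve. all: by end_near. Qed.

Lemma Rint_splitT f x : intR setT f ->
  \int[mu]_t f t = \int[mu]_(t in `]-oo, x]) f t + \int[mu]_(t in `[x, +oo[) f t.
Proof.
move=> fi.
have := @Rintegral_itvB _ f -oo%O +oo%O x.
rewrite set_itv_infty_infty => /(_ fi erefl erefl) H.
have i : intR `]x, +oo[ f by apply: intR_S fi.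
by rewrite -[X in _ + X](Rintegral_itv_obnd_cbnd i) -H addrC subrK.
Qed.

Lemma primitive_Rint0 f g : primitive f g -> intR setT f -> intR setT g ->
  \int[mu]_t g t = 0.
Proof.
move=> pfg fi gi; rewrite (Rint_splitT 0 gi).
by rewrite (primitive_tail_left 0 pfg fi gi) (primitive_tail_right 0 pfg fi gi) subrr.
Qed.

(** Lebesgue differentiation: the integral of [k] from -n is identically zero, so [k] vanishes
    almost everywhere to the right of -n, and countably many n cover the line. *)
Lemma primitive_ae0 k c : measurable_fun setT k -> primitive (cst c) k ->
  {ae mu, forall x, k x = 0}.
Proof.
move=> mk pk.
have loc : locally_integrable [set: R] k.
  split => //; first exact: openT.
  move=> K _ cK.
  have [M [Mr HM]] := compact_bounded cK.
  have ab : - (M + 1) <= M + 1 \/ M + 1 < - (M + 1).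
    by case: (leP (- (M + 1)) (M + 1)); [left|right].
  have sub : K `<=` `[- (M + 1), M + 1].
    move=> z Kz /=; rewrite in_itv/= -ler_norml.
    by apply: (HM (M + 1)) => //; rewrite ltrDl.
  have i : intR `[- (M + 1), M + 1] k.
    case: ab => [ab|ab]; first exact: (pk _ _ ab).1.
    by rewrite set_itv_ge ?bnd_simp -?ltNge//; exact: integrable_set0.
  have mK := compact_measurable cK.
  by have /integrableP[_] : intR K k by apply: intR_S i.
have /ae_foralln H : forall n, {ae mu, forall x, - (n%:R : R) < x -> k x = 0}.
  move=> n.
  have ki y : intR [set` Interval (BLeft (- n%:R)) (BRight y)] k.
    have [h|h] := leP (- n%:R) y; first exact: (pk _ _ h).1.
    by rewrite set_itv_ge ?bnd_simp -?ltNge//; exact: integrable_set0.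
  have := FTC1 ki loc.
  set F := (fun x => _).
  have -> : F = cst 0.
    apply/funext => y; rewrite /F.
    have [h|h] := leP (- n%:R) y; first by rewrite -(pk _ _ h).2 subrr.
    by rewrite set_itv_ge ?bnd_simp -?ltNge// Rintegral_set0.
  apply: ae_imp => x Hx nx; have [|_ <-] := Hx; first by rewrite lte_fin.
  by rewrite derive1_cst.
apply: ae_imp H => x Hx.
apply: (Hx (Num.bound `|x|)).
by rewrite ltrNl; apply: le_lt_trans (archi_boundP _); rewrite // -normrN ler_norm.
Qed.

Lemma primitive_ae_unique f g h : measurable_fun setT g ->
  measurable_fun setT h -> primitive f g -> primitive f h ->
  {ae mu, forall x, g x = h x}.
Proof.
move=> mg mh pg ph.
have H : primitive (cst 0) (fun x => g x - h x).
  move=> x y xy; have [i1 e1] := pg _ _ xy; have [i2 e2] := ph _ _ xy.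
  by split; [exact: intR_B|rewrite RintegralB// -e1 -e2 !subrr].
have := primitive_ae0 (measurable_funB mg mh) H.
by apply: ae_imp => x /eqP; rewrite subr_eq0 => /eqP.
Qed.

Lemma primitive_ae_cst f g : measurable_fun setT g -> primitive f g ->
  {ae mu, forall x, g x = 0} -> forall x y, f x = f y.
Proof.
move=> mg pg g0.
suff H x y : x <= y -> f x = f y.
  by move=> x y; case: (leP x y) => [/H|/ltW /H].
move=> xy; have [i e] := pg _ _ xy.
apply/esym/eqP; rewrite -subr_eq0 e; apply/eqP.
rewrite (@Rint_ae_eq _ _ (cst 0))//; first by rewrite /Rintegral integral0.
  exact: measurable_funTS.
by apply: ae_imp g0 => z ->.
Qed.

(** Turns almost-everywhere identities into pointwise ones: an open condition contradicting [P] near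
    x would be met at some point where [P] holds. *)
Lemma ae_dense (P : R -> Prop) x : {ae mu, forall y, P y} ->
  forall U, nbhs x U -> exists2 y, U y & P y.
Proof.
move=> [N [mN N0 HN]] U /(nbhs_ballP _ _).1[e /= e0 He].
apply: contrapT => H.
have sub : `]x, (x + e)[%classic `<=` N.
  move=> y /=; rewrite in_itv/= => /andP[xy yx]; apply: HN => Py.
  apply: H; exists y => //; apply: He; rewrite /ball/= ltr_norml.
  by apply/andP; split; lra.
have : (mu `]x, (x + e)%R[ <= mu N)%E.
  by apply: le_measure => //; rewrite inE.
rewrite N0 lebesgue_measure_itv/= lte_fin ltrDl e0 -EFinD lee_fin.
lra.
Qed.

End RealIntegral2.

(** * Smooth steps and weak derivatives *)

Section SmoothStep.
Context {R : realType}.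
Local Notation mu := (@lebesgue_measure R).
Local Notation intR A f := (mu.-integrable A (EFin \o f)).

Lemma intR_mkcond A (f : R -> R) : measurable A -> intR A f -> intR setT (f \_ A).
Proof.
move=> mA fi; have := (integrable_mkcond (mu := mu) (EFin \o f) mA).1 fi.
by rewrite restrict_EFin.
Qed.

Section RealDerive.
Variables (f g : R -> R) (x a b : R).
Hypotheses (df : is_derive x 1 f a) (dg : is_derive x 1 g b).

Lemma is_derive_fD : is_derive x 1 (fun z => f z + g z) (a + b).
Proof. exact: is_deriveD. Qed.

Lemma is_derive_fN : is_derive x 1 (fun z => - f z) (- a).
Proof. exact: is_deriveN. Qed.

Lemma is_derive_fM : is_derive x 1 (fun z => f z * g z) (a * g x + f x * b).
Proof.
apply: is_derive_eq (is_deriveM df dg) _; rewrite /GRing.scale/=; ring.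
Qed.

Lemma is_derive_fX n : is_derive x 1 (fun z => f z ^+ n.+1) (n.+1%:R * f x ^+ n * a).
Proof.
elim: n => [|n IH].
  by apply: is_derive_eq df _; rewrite expr0 !mul1r.
have := @is_deriveM _ _ _ _ _ _ _ _ df IH.
rewrite (_ : f * _ = fun z => f z ^+ n.+2); last by apply/funext => z; rewrite exprS.
by move=> /is_derive_eq; apply; rewrite /GRing.scale/= !exprS -!natr1; ring.
Qed.

Lemma is_derive_fV : f x != 0 -> is_derive x 1 (fun z => (f z)^-1) (- (f x)^-1 ^+ 2 * a).
Proof.
move=> fx0; apply: is_derive_eq (is_deriveV fx0 df) _.
by rewrite /GRing.scale/= exprVn.
Qed.

Lemma is_derive_fexp : is_derive x 1 (fun z => expR (f z)) (expR (f x) * a).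
Proof. exact: (is_derive1_comp (is_derive_expR (f x)) df). Qed.

End RealDerive.

Lemma is_derive_affine (x a b : R) : is_derive x 1 (fun z => a * z + b) a.
Proof.
have := is_derive_fD (is_derive_fM (is_derive_cst a x 1) (is_derive_id x 1))
  (is_derive_cst b x 1).
by move=> /is_derive_eq; apply; rewrite /=; ring.
Qed.

(** The powers of 1/x in front of the classical e^(-1/x) make the family stable under
    differentiation, up to linear combinations. *)
Definition flat k (x : R) : R := if 0 < x then x^-1 ^+ k * expR (- x^-1) else 0.

Lemma flat_neg k x : x <= 0 -> flat k x = 0.
Proof. by rewrite /flat ltNge => ->. Qed.

Lemma flat_ge0 k x : 0 <= flat k x.
Proof.
rewrite /flat; case: ifPn => // x0.
by rewrite mulr_ge0 ?expR_ge0// exprn_ge0// invr_ge0 ltW.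
Qed.

Lemma flat0_gt0 x : 0 < x -> 0 < flat 0 x.
Proof. by move=> x0; rewrite /flat x0 expr0 mul1r expR_gt0. Qed.

Lemma expR_ge_pow (t : R) n : 0 <= t -> (t / n.+1%:R) ^+ n.+1 <= expR t.
Proof.
move=> t0; have n0 : 0 < n.+1%:R :> R by [].
have -> : expR t = expR (t / n.+1%:R) ^+ n.+1.
  by rewrite -expRM_natl mulrC divfK// gt_eqF.
apply: lerXn2r; rewrite ?nnegrE ?expR_ge0 ?divr_ge0//.
by apply: le_trans (expR_ge1Dx _); rewrite lerDr.
Qed.

(** The bound e^t >= (t / (k+2))^(k+2) at t = 1/x leaves two powers of x after absorbing x^-k,
    exactly what a zero derivative at the origin requires. *)
Lemma flat_le k : exists2 C, 0 <= C & forall x, flat k x <= C * x ^+ 2.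
Proof.
exists (k.+2%:R ^+ k.+2); first by rewrite exprn_ge0.
move=> x; rewrite /flat; case: ifPn => [x0|_]; last first.
  by rewrite mulr_ge0 ?sqr_ge0// exprn_ge0.
have t0 : 0 <= x^-1 by rewrite invr_ge0 ltW.
have := expR_ge_pow k.+1 t0; rewrite expr_div_n ler_pdivrMr ?exprn_gt0// => H.
rewrite expRN ler_pdivrMr ?expR_gt0//.
have xn : x != 0 by rewrite gt_eqF.
have -> : x^-1 ^+ k = x^-1 ^+ k.+2 * x ^+ 2.
  by rewrite -addn2 exprD -mulrA -exprMn mulVf// expr1n mulr1.
rewrite [leRHS](_ : _ = (expR x^-1 * k.+2%:R ^+ k.+2) * x ^+ 2); last by ring.
by rewrite ler_wpM2r// sqr_ge0.
Qed.

Lemma is_derive0_of_sqr_bound (f : R -> R) C : f 0 = 0 ->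
  (forall x, `|f x| <= C * x ^+ 2) -> is_derive (0 : R) (1 : R) f 0.
Proof.
move=> f0 fC.
have H : h^-1 *: (f (h *: (1 : R) + 0) - f 0) @[h --> 0^'] --> (0 : R).
  apply/norm_cvg0P.
  apply: (@squeeze_cvgr _ _ _ _ (cst 0) (fun h : R => C * `|h|)).
  - near=> h; rewrite /= normr_ge0/= f0 subr0 addr0 normrZ /GRing.scale/= mulr1 normfV.
    have h0 : h != 0 by near: h; exact: nbhs_dnbhs_neq.
    rewrite ler_pdivrMl ?normr_gt0//; apply: (le_trans (fC _)).
    have -> : `|h| * (C * `|h|) = C * `|h| ^+ 2 by ring.
    by rewrite real_normK ?num_real.
  - exact: cvg_cst.
  - rewrite -[X in _ --> X](mulr0 C); apply: cvgMr.
    apply/norm_cvg0P; apply: cvg_within_filter => //; exact: cvg_id.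
apply: DeriveDef; first by apply/cvg_ex; exists 0.
by apply: cvg_lim => //; exact: Rhausdorff.
Unshelve. all: by end_near. Qed.

Lemma is_derive_near_eq (f g : R -> R) (x d : R) : (\near x, f x = g x) ->
  is_derive x 1 f d -> is_derive x 1 g d.
Proof.
by move=> fg H; apply: near_eq_is_derive H => //; rewrite ?oner_eq0.
Qed.

Lemma flat_derive k (x : R) :
  is_derive x 1 (flat k) (flat k.+2 x - k%:R * flat k.+1 x).
Proof.
have [x0|x0|x0] := ltgtP x 0.
- rewrite !flat_neg ?ltW// mulr0 subr0.
  apply: (@is_derive_near_eq (cst 0)).
  near=> z; rewrite /= flat_neg// ltW//; near: z; exact: lt_nbhsl.
- apply: (@is_derive_near_eq (fun x => x^-1 ^+ k * expR (- x^-1))).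
    by near=> z; rewrite /flat ifT//; near: z; exact: lt_nbhsr.
  rewrite /flat x0.
  have xn : x != 0 by rewrite gt_eqF.
  have d1 := is_derive_fV (is_derive_id x 1) xn.
  have d4 := is_derive_fexp (is_derive_fN d1).
  case: k => [|k] /=.
    have := is_derive_fM (is_derive_cst (1 : R) x 1) d4.
    by move=> /is_derive_eq; apply; rewrite /= ?expr0; field.
  have := is_derive_fM (is_derive_fX d1 k) d4.
  by move=> /is_derive_eq; apply; rewrite /= !exprS; field.
- rewrite x0 !flat_neg// mulr0 subr0.
  have [C C0 HC] := flat_le k.
  apply: (@is_derive0_of_sqr_bound _ C); first exact: flat_neg.
  by move=> z; rewrite ger0_norm ?flat_ge0.
Unshelve. all: by end_near. Qed.

(** A syntactic class in which every member has a derivative in the class. Derivability at all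
    orders then follows by induction, without product or quotient rules of order n. *)
Inductive smooth : (R -> R) -> Prop :=
| smooth_flat k : smooth (flat k)
| smooth_cst c : smooth (fun=> c)
| smooth_add f g : smooth f -> smooth g -> smooth (fun x => f x + g x)
| smooth_mul f g : smooth f -> smooth g -> smooth (fun x => f x * g x)
| smooth_inv f : smooth f -> (forall x, f x != 0) -> smooth (fun x => (f x)^-1)
| smooth_affine f a b : smooth f -> smooth (fun x => f (a * x + b)).

Lemma smooth_derive f : smooth f ->
  exists2 g, smooth g & forall x : R, is_derive x 1 f (g x).
Proof.
elim=> {f} [k|c|f g _ [f' sf' df] _ [g' sg' dg]|f g sf [f' sf' df] sg [g' sg' dg]
  |f sf [f' sf' df] f0|f a b sf [f' sf' df]].
(* Here and below a constant is written as an applied constant function, so that the term has the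
   shape of [smooth_mul] and [smooth_cst]. *)
- exists (fun x => flat k.+2 x + (fun=> - k%:R) x * flat k.+1 x).
    by apply: smooth_add; [|apply: smooth_mul]; constructor.
  by move=> x; apply: is_derive_eq (flat_derive k x) _; ring.
- by exists (fun=> 0); [exact: smooth_cst|move=> x; exact: is_derive_cst].
- by exists (fun x => f' x + g' x); [exact: smooth_add|move=> x; exact: is_deriveD].
- exists (fun x => f' x * g x + f x * g' x).
    by apply: smooth_add; exact: smooth_mul.
  by move=> x; exact: is_derive_fM.
- exists (fun x => ((fun=> -1) x * ((f x)^-1 * (f x)^-1)) * f' x).
    apply: smooth_mul => //; apply: smooth_mul; first exact: smooth_cst.
    by apply: smooth_mul; exact: smooth_inv.
  by move=> x; apply: is_derive_eq (is_derive_fV (df x) (f0 x)) _; rewrite expr2; ring.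
- exists (fun x => (fun=> a) x * f' (a * x + b)).
    by apply: smooth_mul; [exact: smooth_cst|exact: smooth_affine].
  move=> x.
  by apply: is_derive_eq (is_derive1_comp (df _) (is_derive_affine x a b)) _; rewrite mulrC.
Qed.

Lemma smooth_derive1n f n : smooth f -> smooth (derive1n n f).
Proof.
move=> sf; elim: n => [//|n IH].
have [g sg dg] := smooth_derive IH.
rewrite derive1nS; suff -> : derive1 (derive1n n f) = g by [].
by apply/funext => x; rewrite derive1E; exact: (@derive_val _ _ _ _ _ _ _ (dg x)).
Qed.

Lemma smooth_derivable f n x : smooth f -> derivable (derive1n n f) x 1.
Proof.
move=> /smooth_derive1n-/(_ n)/smooth_derive[g _ dg].
exact: (@ex_derive _ _ _ _ _ _ _ (dg x)).
Qed.

Lemma is_derive_continuous (f f' : R -> R) :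
  (forall x : R, is_derive x 1 f (f' x)) -> continuous f.
Proof.
move=> df z; apply: differentiable_continuous; apply/derivable1_diffP.
exact: (@ex_derive _ _ _ _ _ _ _ (df z)).
Qed.

Lemma smooth_continuous f : smooth f -> continuous f.
Proof. by move=> /smooth_derive[g _ dg]; exact: is_derive_continuous dg. Qed.

Lemma smooth_step : exists th th' : R -> R, exists M : R,
  [/\ smooth th, continuous th', forall x : R, is_derive x 1 th (th' x) &
   [/\ forall x, x <= 0 -> th x = 0, forall x, 1 <= x -> th x = 1,
    forall x, 0 <= th x <= 1, forall x, ~~ (0 <= x <= 1) -> th' x = 0 &
    forall x, `|th' x| <= M]].
Proof.
(* Denominator of the classical smooth step; it is positive because x and 1 - x are never both
   nonpositive. *)
pose den x := flat 0 x + flat 0 (-1 * x + 1).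
have den0 x : 0 < den x.
  rewrite /den; have [x0|x0] := ltP 0 x.
    by rewrite ltr_pwDl ?flat0_gt0 ?flat_ge0.
  by rewrite ltr_wpDl ?flat0_gt0 ?flat_ge0//; lra.
pose th x := flat 0 x * (den x)^-1.
have sth : smooth th.
  apply: smooth_mul; first exact: smooth_flat.
  apply: smooth_inv => [|x]; last by rewrite gt_eqF.
  apply: smooth_add; first exact: smooth_flat.
  by apply: (@smooth_affine (flat 0)); exact: smooth_flat.
have [th' sth' dth] := smooth_derive sth.
have cth' := smooth_continuous sth'.
have th0 x : x <= 0 -> th x = 0 by move=> x0; rewrite /th flat_neg// mul0r.
have th1 x : 1 <= x -> th x = 1.
  move=> x1; rewrite /th /den [flat 0 (-1 * x + 1)]flat_neg ?addr0; last by lra.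
  by rewrite divff// gt_eqF// flat0_gt0//; lra.
have th01 x : 0 <= th x <= 1.
  rewrite /th divr_ge0 ?flat_ge0 ?(ltW (den0 x))//=.
  by rewrite ler_pdivrMr// mul1r /den lerDl flat_ge0.
have th'0 x : ~~ (0 <= x <= 1) -> th' x = 0.
  rewrite negb_and -!ltNge => /orP[x0|x1].
    have : is_derive x 1 th 0.
      apply: (@is_derive_near_eq (cst 0)).
      by near=> z; rewrite /= th0// ltW//; near: z; exact: lt_nbhsl.
    by move=> h; rewrite -(@derive_val _ _ _ _ _ _ _ (dth x)) (@derive_val _ _ _ _ _ _ _ h).
  have : is_derive x 1 th 0.
    apply: (@is_derive_near_eq (cst 1)).
    by near=> z; rewrite /= th1// ltW//; near: z; exact: lt_nbhsr.
  by move=> h; rewrite -(@derive_val _ _ _ _ _ _ _ (dth x)) (@derive_val _ _ _ _ _ _ _ h).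
have [M [Mr HM]] : bounded_set (th' @` `[0, 1]%classic).
  apply: compact_bounded; apply: continuous_compact; last exact: segment_compact.
  exact: continuous_subspaceT.
exists th, th', (Num.max 0 (M + 1)); split => //; split => // x.
have [x01|x01] := boolP (0 <= x <= 1); last by rewrite th'0// normr0 le_max lexx.
rewrite le_max; apply/orP; right.
by apply: (HM (M + 1)); [rewrite ltrDl|exists x => //=; rewrite in_itv].
Unshelve. all: by end_near. Qed.

Lemma Rint_support A (f : R -> R) : (forall x, ~ A x -> f x = 0) ->
  \int[mu]_x f x = \int[mu]_(x in A) f x.
Proof.
move=> fA; rewrite [RHS]Rintegral_mkcond; apply: eq_Rintegral => x _.
by rewrite patchE; case: ifPn => // /negP; rewrite inE => /fA.
Qed.

(** The kernel is the derivative of the step rescaled to [[x, x + 1/(n+1)]], so its integral is 1.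
    Its sign is not known, and the bound M on |th'| serves to bound its L^1 norm by M. *)
Lemma mollify (f th th' : R -> R) (M x : R) : continuous f -> continuous th' ->
  (forall x : R, is_derive x 1 th (th' x)) -> th 0 = 0 ->
  (forall x, 1 <= x -> th x = 1) -> (forall x, ~~ (0 <= x <= 1) -> th' x = 0) ->
  (forall x, `|th' x| <= M) ->
  \int[mu]_z (f z * (n.+1%:R * th' (n.+1%:R * z + - (n.+1%:R * x)))) @[n --> \oo] --> f x.
Proof.
move=> cf cth' dth th0 th1 th'0 thM.
have M0 : 0 <= M by apply: le_trans (thM 0).
pose k n z := n.+1%:R * th' (n.+1%:R * z + - (n.+1%:R * x)).
have ck n : continuous (k n).
  move=> z; apply: cvgMr; apply: continuous_comp; last exact: cth'.
  by apply: cvgD; [apply: cvgMr; exact: cvg_id|exact: cvg_cst].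
have pk n : primitive (fun z => th (n.+1%:R * z + - (n.+1%:R * x))) (k n).
  apply: derive_primitive => // z.
  by apply: is_derive_eq (is_derive1_comp (dth _) (is_derive_affine z _ _)) _; rewrite mulrC.
pose I n := `[x, x + n.+1%:R^-1]%classic.
have n0 n : 0 < n.+1%:R :> R by [].
have k0 n z : ~ I n z -> k n z = 0.
  move=> zI; rewrite /k th'0 ?mulr0//; apply/negP => /andP[h1 h2]; apply: zI.
  rewrite /I/= in_itv/=.
  have h1' : 0 <= n.+1%:R * (z - x) by rewrite mulrBr.
  have h2' : n.+1%:R * (z - x) <= 1 by rewrite mulrBr.
  move: h1' h2'; rewrite pmulr_rge0// subr_ge0 => ->/=.
  by rewrite -ler_pdivlMl// mulr1 lerBlDl.
have xI n : x <= x + n.+1%:R^-1 by rewrite lerDl invr_ge0.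
have ki n : \int[mu]_(z in I n) k n z = 1.
  rewrite -(pk n _ _ (xI n)).2 mulrDr divff ?gt_eqF//.
  rewrite (addrC _ 1) addrK th1// subrr th0 subr0//.
apply/cvgrPdist_le => e e0.
have eM : 0 < e / (M + 1) by rewrite divr_gt0// ltr_wpDl.
have /cvgrPdist_lt/(_ _ eM)/(nbhs_ballP _ _).1[d /= d0 Hd] := cf x.
near=> n.
have nd : n.+1%:R^-1 < d.
  rewrite invf_plt ?posrE//.
  by apply: (@lt_le_trans _ _ n%:R); [near: n; exact: nbhs_infty_gtr|rewrite ler_nat].
rewrite (@Rint_support (I n)); last by move=> z /k0; rewrite /k => ->; rewrite mulr0.
have mI : measurable (I n) by exact: measurable_itv.
have ikn : intR (I n) (k n) by exact: continuous_intR.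
have fxE : f x = \int[mu]_(z in I n) (f x * k n z) by rewrite RintegralZl// ki mulr1.
rewrite [X in X - _]fxE -RintegralB//; last 2 first.
  exact: intR_Z.
  exact: intR_contM.
have ifk : intR (I n) (fun z => f x * k n z - f z * k n z).
  by apply: intR_B => //; [exact: intR_Z|exact: intR_contM].
apply: le_trans (le_normr_Rintegral _ _) _ => //.
have ic : intR (I n) (fun _ : R => e / (M + 1) * (n.+1%:R * M)).
  by apply: continuous_intR => z; exact: cvg_cst.
apply: (@le_trans _ _ (\int[mu]_(z in I n) (e / (M + 1) * (n.+1%:R * M)))).
  apply: le_Rintegral => //; first exact: intR_norm.
  move=> z; rewrite /I/= in_itv/= => /andP[xz zx].
  rewrite -mulrBl normrM; apply: ler_pM => //.
    apply: ltW; apply: Hd; rewrite /ball/= distrC ger0_norm ?subr_ge0//.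
    by rewrite ltrBlDl; apply: le_lt_trans zx _; rewrite ltrD2l.
  by rewrite normrM ger0_norm// ler_wpM2l.
have m1 : fine (mu (I n)) = n.+1%:R^-1.
  by rewrite /I lebesgue_measure_itv/= lte_fin ltrDl invr_gt0 n0/= addrAC subrr add0r.
rewrite Rintegral_cst//.
have -> : e / (M + 1) * (n.+1%:R * M) * fine (mu (I n)) = e * (M / (M + 1)).
  by rewrite m1; field; rewrite !gt_eqF// ltr_wpDl.
apply: ler_piMr; first exact: ltW.
by rewrite ler_pdivrMr ?ltr_wpDl// mul1r lerDl.
Unshelve. all: by end_near. Qed.

(** The test functions [psi n] are smooth plateaus built from a step up at x and a step down at y.
    Their derivatives concentrate at x and y, so the left side tends to f x - f y by [mollify],
    while the right side tends to minus the integral of [g] by dominated convergence. *)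
Lemma distributional_primitive (f g : R -> R) : continuous f ->
  measurable_fun setT g -> (forall a b, intR `[a, b] g) ->
  (forall psi, test_function psi ->
     \int[mu]_x (f x * derive1 psi x) = - \int[mu]_x (g x * psi x)) ->
  primitive f g.
Proof.
move=> cf mg gi H x y xy; split; first exact: gi.
have [th [th' [M [sth cth' dth [th0 th1 th01 th'0 thM]]]]] := smooth_step.
pose psi n z := th (n.+1%:R * z + - (n.+1%:R * x)) +
  (fun=> -1) z * th (n.+1%:R * z + - (n.+1%:R * y)).
have n0 n : 0 < n.+1%:R :> R by [].
have s1 n : smooth (psi n).
  apply: smooth_add; first exact: smooth_affine.
  by apply: smooth_mul; [exact: smooth_cst|exact: smooth_affine].
have psiL n z : z <= x -> psi n z = 0.
  move=> zx; rewrite /psi !th0 ?mulr0 ?addr0// -mulrBr pmulr_rle0// subr_le0//.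
  exact: le_trans xy.
have psiR n z : y + n.+1%:R^-1 <= z -> psi n z = 0.
  move=> zy; rewrite /psi !th1 ?mulr1 ?subrr//.
    by rewrite -mulrBr -ler_pdivrMl// mulr1 lerBrDl.
  rewrite -mulrBr -ler_pdivrMl// mulr1 lerBrDl; apply: le_trans zy.
  by rewrite lerD2r.
have n1 n : n.+1%:R^-1 <= 1 :> R by rewrite invf_le1// ler1n.
have tf n : test_function (psi n).
  split; first by move=> m z; exact: smooth_derivable.
  apply: (@subclosed_compact _ _ `[x, y + 1]%classic).
  - exact: closed_closure.
  - exact: segment_compact.
  - rewrite [X in _ `<=` X](closure_id _).1; last exact: itv_closed.
    apply: closureS => z /=; rewrite in_itv/= => /negP h.
    apply/andP; split; rewrite leNgt; apply/negP => hz; apply: h; apply/eqP.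
      by rewrite psiL// ltW.
    by rewrite psiR// (le_trans _ (ltW hz))// lerD2l.
have dpsi n z : derive1 (psi n) z = n.+1%:R * th' (n.+1%:R * z + - (n.+1%:R * x)) -
    n.+1%:R * th' (n.+1%:R * z + - (n.+1%:R * y)).
  have d1 c := is_derive1_comp (dth _) (is_derive_affine z n.+1%:R (- (n.+1%:R * c))).
  have dd := is_derive_fD (d1 x) (is_derive_fM (is_derive_cst (-1 : R) z 1) (d1 y)).
  rewrite derive1E (@derive_val _ _ _ _ _ _ _ dd) /=; ring.
have L1 := @mollify f th th' M x cf cth' dth (th0 _ (lexx _)) th1 th'0 thM.
have L2 := @mollify f th th' M y cf cth' dth (th0 _ (lexx _)) th1 th'0 thM.
have isup c n : intR setT (fun z => f z * (n.+1%:R * th' (n.+1%:R * z + - (n.+1%:R * c)))).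
  have cc : continuous (fun z => f z * (n.+1%:R * th' (n.+1%:R * z + - (n.+1%:R * c)))).
    move=> z; apply: cvgM; first exact: cf.
    apply: cvgMr; apply: continuous_comp; last exact: cth'.
    by apply: cvgD; [apply: cvgMr; exact: cvg_id|exact: cvg_cst].
  have : intR setT ((fun z => f z * (n.+1%:R * th' (n.+1%:R * z + - (n.+1%:R * c)))) \_ `[c, c + 1]).
    apply: intR_mkcond => //.
    exact: continuous_intR.
  apply: intR_eq => // z _; rewrite patchE; case: ifPn => // /negP.
  rewrite inE/= in_itv/= => h; rewrite th'0 ?mulr0//; apply/negP => /andP[h1 h2].
  apply: h; move: h1 h2; rewrite -mulrBr pmulr_rge0// subr_ge0 => ->/=.
  by rewrite -ler_pdivlMl// mulr1 => h; rewrite -lerBlDl (le_trans h).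
have L3 : \int[mu]_z (f z * derive1 (psi n) z) @[n --> \oo] --> f x - f y.
  rewrite [X in X @ \oo](_ : _ = fun n =>
    \int[mu]_z (f z * (n.+1%:R * th' (n.+1%:R * z + - (n.+1%:R * x)))) -
    \int[mu]_z (f z * (n.+1%:R * th' (n.+1%:R * z + - (n.+1%:R * y))))).
    exact: cvgB.
  apply/funext => n; rewrite -RintegralB//.
  by apply: eq_Rintegral => z _; rewrite dpsi mulrBr.
have L4 : \int[mu]_z (g z * psi n z) @[n --> \oo] --> \int[mu]_(z in `[x, y]) g z.
  (* The half-open interval is the exact pointwise limit: [psi n] is 0 at x for every n, and
     eventually 1 at y. *)
  have -> : \int[mu]_(z in `[x, y]) g z = \int[mu]_z (g \_ `]x, y]) z.
    rewrite -Rintegral_mkcond Rintegral_itv_obnd_cbnd//.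
    by apply: intR_S (gi x y) => //; apply: subset_itvr; rewrite bnd_simp.
  apply: (@Rint_dominated_cvg _ _ _ (fun z => (`|g z|) * \1_(`[x, y + 1]%classic) z)).
  - move=> n; apply: measurable_funM => //.
    by apply: continuous_measurable_fun; exact: smooth_continuous.
  - by apply/(measurable_restrictT _ _).1 => //; exact: measurable_funTS.
  - move=> z; apply: cvg_near_cst; rewrite patchE.
    case: ifPn => [|/negP]; rewrite inE/= in_itv/=.
      move=> /andP[xz zy]; near=> n.
      rewrite /psi th1; last first.
        rewrite -mulrBr -ler_pdivrMr ?subr_gt0// div1r.
        by apply: (@le_trans _ _ n%:R); [near: n; exact: nbhs_infty_ger|rewrite ler_nat].
      by rewrite th0 ?mulr0 ?addr0 ?mulr1// -mulrBr pmulr_rle0// subr_le0.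
    move=> /negP; rewrite negb_and -ltNge -leNgt => /orP[zx|yz].
      by apply: nearW => n; rewrite psiL// mulr0.
    near=> n; rewrite psiR ?mulr0// -lerBrDl invf_ple ?posrE ?subr_gt0//.
    by apply: (@le_trans _ _ n%:R); [near: n; exact: nbhs_infty_ger|rewrite ler_nat].
  - have : intR setT ((fun z => `|g z|) \_ `[x, y + 1]).
      apply: intR_mkcond => //.
      by apply: intR_norm => //; exact: gi.
    apply: intR_eq => // z _; rewrite patchE indicE.
    by case: ifPn => _; rewrite ?mulr1 ?mulr0.
  - move=> n z; rewrite normrM ler_wpM2l// indicE.
    have [zI|/negP zI] := boolP (z \in _).
      rewrite /psi ler_norml; have /andP[a1 a2] := th01 (n.+1%:R * z + - (n.+1%:R * x)).
      have /andP[b1 b2] := th01 (n.+1%:R * z + - (n.+1%:R * y)).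
      by clear -a1 a2 b1 b2; rewrite /= mulN1r; apply/andP; split; lra.
    have [zx|xz] := leP z x; first by rewrite psiL// normr0.
    rewrite psiR ?normr0// leNgt; apply/negP => hz; apply: zI.
    rewrite inE/= in_itv/= (ltW xz)/=; apply: (le_trans (ltW hz)).
    by rewrite lerD2l.
have L5 : (- \int[mu]_z (g z * psi n z)) @[n --> \oo] --> f x - f y.
  have E : (fun n => - \int[mu]_z (g z * psi n z)) =
      (fun n => \int[mu]_z (f z * derive1 (psi n) z)).
    by apply/funext => n; rewrite H.
  by rewrite E.
have L6 : (- \int[mu]_z (g z * psi n z)) @[n --> \oo] --> - \int[mu]_(z in `[x, y]) g z.
  exact: cvgN L4.
have e : f x - f y = - \int[mu]_(z in `[x, y]) g z by exact: cvg_unique L5 L6.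
by rewrite -[RHS]opprK -e opprB.
Unshelve. all: by end_near. Qed.

End SmoothStep.

(** * The Gaussian profile *)

Section RealContinuity.
Context {R : realType}.
Local Notation mu := (@lebesgue_measure R).
Local Notation intR A f := (mu.-integrable A (EFin \o f)).
Implicit Types f g : R -> R.

Lemma continuous_fD f g : continuous f -> continuous g ->
  continuous (fun x => f x + g x).
Proof. by move=> cf cg x; apply: cvgD; [exact: cf|exact: cg]. Qed.

Lemma continuous_fM f g : continuous f -> continuous g ->
  continuous (fun x => f x * g x).
Proof. by move=> cf cg x; apply: cvgM; [exact: cf|exact: cg]. Qed.

Lemma continuous_fsqr f : continuous f -> continuous (fun x => f x ^+ 2).
Proof. by move=> cf; exact: continuous_fM. Qed.

Lemma continuous_fcst (c : R) : continuous (fun _ : R => c).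
Proof. by move=> x; exact: cvg_cst. Qed.

Lemma measurable_sgr : measurable_fun setT (fun x : R => Num.sg x).
Proof.
rewrite (_ : (fun x : R => Num.sg x) =
  (fun x => \1_(`]0, +oo[%classic) x - \1_(`]-oo, 0[%classic) x)).
  by apply: measurable_funB; exact: measurable_indic.
apply/funext => x; rewrite !indicE !mem_setE !in_itv/= andbT.
by case: sgrP => x0 /=; rewrite ?ltxx ?subr0 ?sub0r ?subrr// ?x0// ?(lt_gtF x0) ?subr0 ?sub0r.
Qed.

Lemma intR_sgrM (f : R -> R) : intR setT f -> intR setT (fun x => Num.sg x * f x).
Proof.
move=> fi; apply: (@intR_le _ _ _ (fun x => `|f x|)) => //; last exact: intR_norm.
  by apply: measurable_funM; [exact: measurable_sgr|exact: intR_measurable].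
by move=> x _; rewrite normrM ler_piMl// normr_sg; case: (x != 0).
Qed.

(** The derivative of [Num.sg] is twice the Dirac mass at 0. This is how point values at 0, hence
    the delta interaction, are written as integrals. *)
Lemma primitive_Rint_sgr f g : primitive f g -> intR setT f -> intR setT g ->
  \int[mu]_x (Num.sg x * g x) = - 2 * f 0.
Proof.
move=> pfg fi gi; have si := intR_sgrM gi.
rewrite (Rint_splitT 0 si).
have -> : \int[mu]_(t in `]-oo, 0]) (Num.sg t * g t) = - f 0.
  rewrite -(Rintegral_itv_bndo_bndc (a := -oo%O)); last exact: intR_S si.
  rewrite -(primitive_tail_left 0 pfg fi gi).
  rewrite -(Rintegral_itv_bndo_bndc (a := -oo%O)); last exact: intR_S gi.
  rewrite -mulN1r -RintegralZl//; last exact: intR_S gi.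
  by apply: eq_Rintegral => x; rewrite inE/= in_itv/= => x0; rewrite ltr0_sg.
have -> : \int[mu]_(t in `[0, +oo[) (Num.sg t * g t) = - f 0.
  rewrite -(Rintegral_itv_obnd_cbnd (b := +oo%O)); last exact: intR_S si.
  rewrite -(primitive_tail_right 0 pfg fi gi).
  rewrite -(Rintegral_itv_obnd_cbnd (b := +oo%O)); last exact: intR_S gi.
  by apply: eq_Rintegral => x; rewrite inE/= in_itv/= andbT => x0; rewrite gtr0_sg// mul1r.
ring.
Qed.

End RealContinuity.

(** * The cumulative function of a continuous integrable density *)

Section Cumulative.
Context {R : realType}.
Local Notation mu := (@lebesgue_measure R).
Local Notation intR A f := (mu.-integrable A (EFin \o f)).

Definition cdf (w : R -> R) y := \int[mu]_(x in `]-oo, y]) w x.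

Variable w : R -> R.
Hypotheses (cw : continuous w) (w0 : forall x, 0 <= w x) (wi : intR setT w).
Let m := \int[mu]_x w x.

Lemma cdf_derive (y : R) : is_derive y 1 (cdf w) (w y).
Proof.
have yy : y < y + 1 by lra.
have i : intR [set` Interval -oo%O (BRight (y + 1))] w by apply: intR_S wi.
have [|d e] := @continuous_FTC1 _ w -oo%O y (y + 1) yy i _ (@cw y).
  by rewrite ltNyr.
by apply: DeriveDef; [exact: d|rewrite -derive1E; exact: e].
Qed.

Lemma cdf_compl y : m - cdf w y = \int[mu]_(x in `[y, +oo[) w x.
Proof. by rewrite /m (Rint_splitT y wi) /cdf addrC addKr. Qed.

Lemma cdf_ge0 y : 0 <= cdf w y.
Proof. exact: Rintegral_ge0. Qed.

Lemma cdf_le y : cdf w y <= m.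
Proof. by rewrite -subr_ge0 cdf_compl; exact: Rintegral_ge0. Qed.

Lemma cdf_continuous : continuous (cdf w).
Proof. exact: is_derive_continuous cdf_derive. Qed.

Lemma cdf_itv x y : x <= y -> cdf w y - cdf w x = \int[mu]_(z in `[x, y]) w z.
Proof. by move=> xy; rewrite ((derive_primitive cdf_derive cw) _ _ xy).2. Qed.

Lemma cdf_homo x y : x <= y -> cdf w x <= cdf w y.
Proof. by move=> xy; rewrite -subr_ge0 cdf_itv//; exact: Rintegral_ge0. Qed.

Lemma cdf_lt x y : cdf w x < cdf w y -> x < y.
Proof. by rewrite ltNge => h; rewrite ltNge; apply: contra h; exact: cdf_homo. Qed.

Lemma cdf_surj s : 0 < s < m -> exists y, cdf w y = s.
Proof.
move=> /andP[s0 sm].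
have c1 : cdf w n%:R @[n --> \oo] --> m.
  apply: (@cvg_Rint_sets _ w (fun n => `]-oo, n%:R]%classic)) => // x _.
  by near=> n; rewrite /= in_itv/=; near: n; exact: nbhs_infty_ger.
have c2 : m - cdf w (- n%:R) @[n --> \oo] --> m.
  under eq_fun do rewrite cdf_compl.
  apply: (@cvg_Rint_sets _ w (fun n => `[- n%:R, +oo[%classic)) => // x _.
  by near=> n; rewrite /= in_itv/= andbT lerNl; near: n; exact: nbhs_infty_ger.
have [n1 h1] : exists n : nat, s < cdf w n%:R.
  have : \forall n \near \oo, s < cdf w n%:R by exact: cvgr_gt c1 _ sm.
  by move=> [N _ HN]; exists N; apply: HN => /=.
have [n2 h2] : exists n : nat, m - s < m - cdf w (- n%:R).
  have : \forall n \near \oo, m - s < m - cdf w (- n%:R).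
    by apply: cvgr_gt c2 _ _; rewrite ltrBlDr ltrDl.
  by move=> [N _ HN]; exists N; apply: HN => /=.
have {}h2 : cdf w (- n2%:R) < s by lra.
have ab : - n2%:R < n1%:R :> R by apply: cdf_lt; exact: lt_trans h2 h1.
have [|c _ <-] := @IVT _ (cdf w) _ _ s (ltW ab) (continuous_subspaceT cdf_continuous).
  by rewrite ge_min le_max (ltW h2) (ltW h1) orbT.
by exists c.
Unshelve. all: by end_near. Qed.

(** By continuity [w] is positive on both sides of y, so mass lies on either side. Hence {w <> 0} is
    contained in the set {0 < F < m} on which the transport map is meaningful. *)
Lemma cdf_interior y : w y != 0 -> 0 < cdf w y < m.
Proof.
move=> wy.
have wy0 : 0 < w y by rewrite lt_neqAle eq_sym wy w0.
have pos : \forall z \near y, 0 < w z by exact: cvgr_gt (@cw y) _ wy0.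
have /(nbhs_ballP _ _).1[d /= d0 Hd] := pos.
have H a b : a < b -> (forall z, z \in `[a, b] -> 0 < w z) -> cdf w a < cdf w b.
  move=> ab hz.
  have [|c cab ce] := MVT ab (fun z _ => cdf_derive z).
    exact: continuous_subspaceT cdf_continuous.
  rewrite -subr_gt0 ce mulr_gt0 ?subr_gt0// hz//.
  by move: cab; rewrite !in_itv/= => /andP[h1 h2]; rewrite !ltW.
apply/andP; split.
  apply: le_lt_trans (cdf_ge0 (y - d / 2)) _; apply: H; first lra.
  move=> z; rewrite in_itv/= => /andP[z1 z2]; apply: Hd.
  by rewrite /ball/= ltr_norml; apply/andP; split; lra.
apply: lt_le_trans (cdf_le (y + d / 2)); apply: H; first lra.
move=> z; rewrite in_itv/= => /andP[z1 z2]; apply: Hd.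
by rewrite /ball/= ltr_norml; apply/andP; split; lra.
Qed.

End Cumulative.

(** * The profile [phi]: logarithmic derivative, moments and tails *)

Section Profile.
Context {R : realType}.
Local Notation mu := (@lebesgue_measure R).
Local Notation intR A f := (mu.-integrable A (EFin \o f)).
Variables gamma omega : R.
Hypothesis gamma0 : 0 < gamma.

Local Notation p := (phi omega gamma).
Definition pot (x : R) := (`|x| + gamma / 2) ^+ 2.
(** Half the derivative of [pot] away from 0, so that -drift is the logarithmic derivative of [phi].
    At 0 it is 0, whereas [pot] there is (gamma/2)^2. *)
Definition drift (x : R) := x + Num.sg x * (gamma / 2).

Lemma phi_gt0 x : 0 < p x.
Proof. by rewrite /phi mulr_gt0 ?expR_gt0. Qed.

Lemma phi_sqr x : p x ^+ 2 = expR (omega + 1 - pot x).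
Proof.
rewrite /phi -expRD -expRM_natl; congr expR; rewrite /pot.
by set y := _ ^+ 2; field.
Qed.

Lemma ln_phi_sqr x : ln (p x ^+ 2) = omega + 1 - pot x.
Proof. by rewrite phi_sqr expRK. Qed.

Lemma continuous_absr : continuous (fun x : R => `|x|).
Proof. by move=> x; apply: cvg_norm; exact: cvg_id. Qed.

Lemma pot_continuous : continuous pot.
Proof.
move=> x; rewrite /pot; apply: (@continuous_comp _ _ _ (fun x : R => `|x| + gamma / 2) (fun y => y ^+ 2)).
  by apply: cvgD; [exact: continuous_absr|exact: cvg_cst].
exact: exprn_continuous.
Qed.

Lemma pot_ge0 x : 0 <= pot x. Proof. exact: sqr_ge0. Qed.

Lemma sqr_le_pot x : x ^+ 2 <= pot x.
Proof.
have g0 : 0 <= gamma / 2 by rewrite divr_ge0// ltW.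
rewrite /pot -(real_normK (num_real x)).
by apply: lerXn2r; rewrite ?nnegrE ?addr_ge0// lerDl.
Qed.

Lemma drift_sqr x : x != 0 -> drift x ^+ 2 = pot x.
Proof.
move=> x0; rewrite /drift /pot {1}(numEsg x) -mulrDr exprMn sqr_sg x0.
by rewrite mul1r.
Qed.

Lemma drift_sqr_le x : drift x ^+ 2 <= pot x.
Proof.
have [->|x0] := eqVneq x 0; last by rewrite drift_sqr.
by rewrite /drift sgr0 mul0r addr0 expr0n pot_ge0.
Qed.

Lemma phi_continuous : continuous p.
Proof.
move=> x; rewrite /phi; apply: cvgMr.
apply: (@continuous_comp _ _ _ (fun x => - 2^-1 * pot x) expR); last exact: continuous_expR.
by apply: cvgMr; exact: pot_continuous.
Qed.

Lemma measurable_drift : measurable_fun setT drift.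
Proof.
apply: measurable_funD => //.
by apply: measurable_funM => //; exact: measurable_sgr.
Qed.

(** Stated for any coefficient c to serve both [phi] (c = -1/2) and its inverse (c = 1/2). On each
    half-line |x| is s x with s = -1 or 1, an ordinary smooth function, and the halves are glued at
    0. *)
Lemma gauss_primitive A c : primitive (fun x => expR A * expR (c * pot x))
  (fun x => 2 * c * drift x * (expR A * expR (c * pot x))).
Proof.
pose f (s : R) (x : R) := expR A * expR (c * (s * x + gamma / 2) ^+ 2).
pose g s x := 2 * c * (s * (s * x + gamma / 2)) * f s x.
have pfg s : primitive (f s) (g s).
  have df (x : R) : is_derive x 1 (f s) (g s x).
    have := is_derive_fM (is_derive_cst (expR A : R) x 1)
      (is_derive_fexp (is_derive_fM (is_derive_cst (c : R) x 1)
        (is_derive_fX (is_derive_affine x s (gamma / 2)) 1))).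
    by move=> /is_derive_eq; apply; rewrite /g /f /=; ring.
  apply: derive_primitive => //.
  apply: continuous_fM; last exact: (is_derive_continuous df).
  apply: continuous_fM; first exact: continuous_fcst.
  apply: continuous_fM; first exact: continuous_fcst.
  apply: continuous_fD; last exact: continuous_fcst.
  by apply: continuous_fM; [exact: continuous_fcst|move=> x; exact: cvg_id].
apply: (primitive_glue0 (pfg (-1)) (pfg 1)) => x x0.
- by rewrite /pot /f mulN1r ler0_norm.
- by rewrite /pot /f mul1r ger0_norm.
- by rewrite /g /f /pot /drift (ltr0_sg x0) (ltr0_norm x0) -(mulN1r x); congr (_ * _); ring.
- by rewrite /g /f /pot /drift (gtr0_sg x0) (gtr0_norm x0) !mul1r.
Qed.

Lemma phi_primitive : primitive p (fun x => - drift x * p x).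
Proof.
have -> : (fun x => - drift x * p x) = (fun x => 2 * (- 2^-1) * drift x *
    (expR ((omega + 1) / 2) * expR (- 2^-1 * pot x))).
  by apply/funext => x; rewrite mulrN divff ?mulN1r.
exact: gauss_primitive.
Qed.

(** The integrating factor with which u' = - drift u is solved in the equality case. *)
Lemma phi_inv_primitive :
  primitive (fun x => (p x)^-1) (fun x => drift x * (p x)^-1).
Proof.
have e : (fun x => (p x)^-1) =
    (fun x => expR (- ((omega + 1) / 2)) * expR (2^-1 * pot x)).
  by apply/funext => x; rewrite /phi invfM -!expRN mulNr opprK.
have -> : (fun x => drift x * (p x)^-1) = (fun x => 2 * 2^-1 * drift x *
    (expR (- ((omega + 1) / 2)) * expR (2^-1 * pot x))).
  by apply/funext => x; rewrite divff// mul1r; congr (_ * _); exact: (congr1 (@^~ x) e).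
by rewrite e; exact: gauss_primitive.
Qed.

(** In e^(-pot) = e^(-pot/2) e^(-pot/2) one factor absorbs pot^2 and the other is below the standard
    Gaussian, since pot >= x^2. *)
Lemma pot2_phi2_int : intR setT (fun x => pot x ^+ 2 * p x ^+ 2).
Proof.
have i : intR setT (normal_fun 0 1 : R -> R).
  have := @intR_Z _ setT (normal_peak 1)^-1 _ measurableT (@integrable_normal_pdf R 0 1).
  apply: intR_eq => // x _; rewrite normal_pdfE ?oner_eq0// mulKf//.
  by rewrite gt_eqF// normal_peak_gt0// oner_eq0.
have cV : continuous (fun x => pot x ^+ 2 * p x ^+ 2).
  by apply: continuous_fM; apply: continuous_fsqr;
    [exact: pot_continuous|exact: phi_continuous].
apply: (@intR_le _ _ _ (fun x => 16 * expR (omega + 1) * normal_fun 0 1 x)) => //.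
- exact: continuous_measurable_fun.
- move=> x _; rewrite ger0_norm; last by rewrite mulr_ge0// sqr_ge0.
  rewrite phi_sqr /normal_fun.
  (* With t = pot/2, the bound (t/2)^2 <= e^t reads pot^2 <= 16 e^(pot/2), whence the 16. *)
  have := @expR_ge_pow R (pot x / 2) 1; rewrite divr_ge0 ?pot_ge0// => /(_ isT) h.
  have -> : expR (omega + 1 - pot x) = expR (omega + 1) * expR (- (pot x / 2)) / expR (pot x / 2).
    by rewrite -expRN -!expRD; congr expR; field.
  have h1 : pot x ^+ 2 <= 16 * expR (pot x / 2).
    by apply: le_trans (ler_wpM2l _ h); rewrite // [leRHS](_ : _ = pot x ^+ 2)//; field.
  have h2 : expR (- (pot x / 2)) <= expR (- (x - 0) ^+ 2 / (1 ^+ 2 *+ 2)).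
    rewrite ler_expR subr0 expr1n mulNr lerN2.
    by rewrite ler_pM2r ?invr_gt0// sqr_le_pot.
  rewrite mulrA ler_pdivrMr ?expR_gt0//.
  apply: (@le_trans _ _ (16 * expR (pot x / 2) * (expR (omega + 1) * expR (- (pot x / 2))))).
    by rewrite ler_wpM2r// mulr_ge0 ?expR_ge0.
  rewrite [leLHS](_ : _ = 16 * expR (omega + 1) * expR (- (pot x / 2)) * expR (pot x / 2)); last by ring.
  by rewrite ler_wpM2r ?expR_ge0// ler_wpM2l// mulr_ge0 ?expR_ge0.
- exact: intR_Z.
Qed.

Lemma phi2_continuous : continuous (fun x => p x ^+ 2).
Proof. by apply: continuous_fsqr; exact: phi_continuous. Qed.

(** As gamma > 0, [pot] stays above (gamma/2)^2 > 0, so lower powers of [pot] are dominated by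
    higher ones; [phi2_int] follows in the same way. *)
Lemma pot_phi2_int : intR setT (fun x => pot x * p x ^+ 2).
Proof.
have g0 : 0 <= gamma / 2 by rewrite divr_ge0// ltW.
have g2 : 0 < (gamma / 2) ^+ 2 by rewrite exprn_gt0// divr_gt0.
apply: (@intR_le _ _ _ (fun x => ((gamma / 2) ^+ 2)^-1 * (pot x ^+ 2 * p x ^+ 2))) => //.
- apply: continuous_measurable_fun; apply: continuous_fM; first exact: pot_continuous.
  exact: phi2_continuous.
- move=> x _; rewrite ger0_norm; last by apply: mulr_ge0; [exact: pot_ge0|exact: sqr_ge0].
  rewrite [leRHS]mulrA ler_wpM2r ?sqr_ge0// ler_pdivlMl// [pot x ^+ 2]expr2 ler_wpM2r ?pot_ge0//.
  by apply: lerXn2r; rewrite ?nnegrE ?addr_ge0 ?lerDr.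
- by apply: intR_Z => //; exact: pot2_phi2_int.
Qed.

Lemma phi2_int : intR setT (fun x => p x ^+ 2).
Proof.
have g0 : 0 <= gamma / 2 by rewrite divr_ge0// ltW.
have g2 : 0 < (gamma / 2) ^+ 2 by rewrite exprn_gt0// divr_gt0.
apply: (@intR_le _ _ _ (fun x => ((gamma / 2) ^+ 2)^-1 * (pot x * p x ^+ 2))) => //.
- by apply: continuous_measurable_fun; exact: phi2_continuous.
- move=> x _; rewrite ger0_norm ?sqr_ge0//.
  rewrite [leRHS]mulrA ler_peMl ?sqr_ge0// ler_pdivlMl// mulr1.
  by apply: lerXn2r; rewrite ?nnegrE ?addr_ge0 ?lerDr.
- by apply: intR_Z => //; exact: pot_phi2_int.
Qed.

Local Notation G := (cdf (fun x => p x ^+ 2)).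
Local Notation mp := (\int[mu]_x (p x ^+ 2)).
Local Notation M4 := (\int[mu]_x (pot x ^+ 2 * p x ^+ 2)).

Lemma phi2_gt0 x : 0 < p x ^+ 2. Proof. by rewrite exprn_gt0 ?phi_gt0. Qed.

Lemma phi_mass_gt0 : 0 < mp.
Proof.
have /andP[h1 h2] : 0 < G 0 < mp.
  apply: cdf_interior; [exact: phi2_continuous|by move=> x; exact: sqr_ge0|exact: phi2_int|].
  by rewrite gt_eqF ?phi2_gt0.
exact: lt_trans h2.
Qed.

Lemma phi_cdf_inj : injective G.
Proof.
have H x y : x < y -> G x < G y.
  move=> xy; have [|c cab ce] := MVT xy (fun z _ => cdf_derive phi2_continuous phi2_int z).
    apply: continuous_subspaceT.
    by apply: cdf_continuous; [exact: phi2_continuous|exact: phi2_int].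
  by rewrite -subr_gt0 ce mulr_gt0 ?subr_gt0// phi2_gt0.
by move=> x y; have [/H|/H|//] := ltgtP x y => h e; rewrite e ltxx in h.
Qed.

(** A Chebyshev inequality with the fourth moment, since pot^2 >= x^4 >= t^4 beyond t. Both tails
    are assumed to have mass at least s because the sign of t decides which half-line lies beyond
    t. *)
Lemma phi_tail t s : 0 <= s -> s <= G t -> s <= mp - G t -> t ^+ 4 * s <= M4.
Proof.
move=> s0 s1 s2.
have i4 := pot2_phi2_int; have i0 := phi2_int.
have key (A : set R) : measurable A -> (forall x, A x -> t ^+ 2 <= x ^+ 2) ->
    s <= \int[mu]_(x in A) (p x ^+ 2) -> t ^+ 4 * s <= M4.
  move=> mA hA hs.
  apply: (@le_trans _ _ (t ^+ 4 * \int[mu]_(x in A) (p x ^+ 2))).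
    by rewrite ler_wpM2l// (exprM _ 2 2) sqr_ge0.
  rewrite -RintegralZl//; last exact: intR_S i0.
  apply: (@le_trans _ _ (\int[mu]_(x in A) (pot x ^+ 2 * p x ^+ 2))).
    apply: le_Rintegral => //.
    - by apply: intR_Z => //; exact: intR_S i0.
    - exact: intR_S i4.
    move=> x Ax; rewrite ler_wpM2r ?sqr_ge0// (exprM _ 2 2).
    apply: lerXn2r; rewrite ?nnegrE ?sqr_ge0//.
    by apply: le_trans (sqr_le_pot x); exact: hA.
  by apply: Rint_le_subset => // x; rewrite mulr_ge0 ?sqr_ge0.
have [t0|t0] := leP t 0.
  apply: (key `]-oo, t]%classic) => // x /=; rewrite in_itv/= => xt.
  rewrite -(sqrrN t) -(sqrrN x); apply: lerXn2r; rewrite ?nnegrE ?lerN2 ?oppr_ge0//.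
  exact: le_trans t0.
apply: (key `[t, +oo[%classic) => //.
  move=> x /=; rewrite in_itv/= andbT => xt.
  by apply: lerXn2r; rewrite ?nnegrE// ?(ltW t0)//; apply: le_trans xt; exact: ltW.
by rewrite -cdf_compl//; exact: phi2_int.
Qed.

End Profile.

(** * Mass transport onto the profile *)

Section Clip.
Context {R : realType}.
Local Notation mu := (@lebesgue_measure R).
Local Notation intR A f := (mu.-integrable A (EFin \o f)).

(** The transport map is differentiable only on {0 < F < m}. Freezing it outside [[a, b]] gives a
    function that is absolutely continuous on the whole line, to which [primitive_M] applies. *)
Lemma primitive_clip (T T' : R -> R) (a b : R) : a <= b ->
  (forall x, a <= x <= b -> is_derive x 1 T (T' x)) ->
  (forall x, a <= x <= b -> {for x, continuous T'}) ->
  primitive (fun x => T (Num.min (Num.max x a) b)) (T' \_ `[a, b]).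
Proof.
move=> ab dT cT'.
have cT x : a <= x <= b -> {for x, continuous T}.
  move=> xab; apply: differentiable_continuous; apply/derivable1_diffP.
  exact: (@ex_derive _ _ _ _ _ _ _ (dT x xab)).
have wT' x y : a <= x -> y <= b -> {within `[x, y], continuous T'}.
  move=> ax yb; apply: continuous_in_subspaceT => z.
  rewrite inE/= in_itv/= => /andP[xz zy]; apply: cT'.
  by rewrite (le_trans ax xz) (le_trans zy yb).
have i0 x y : a <= x -> y <= b -> intR `[x, y] T'.
  move=> ax yb; apply: continuous_compact_integrable; first exact: segment_compact.
  exact: wT'.
have FTC x y : a <= x -> x <= y -> y <= b ->
    T y - T x = \int[mu]_(z in `[x, y]) T' z.
  move=> ax; rewrite le_eqVlt => /predU1P[->|xy] yb.
    by rewrite Rint_point subrr.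
  rewrite /Rintegral (@continuous_FTC2 _ T' T)//; first exact: wT'.
    split.
    - move=> z; rewrite in_itv/= => /andP[xz zy].
      apply: (@ex_derive _ _ _ _ _ _ _ (dT z _)).
      by rewrite (le_trans ax (ltW xz)) (le_trans (ltW zy) yb).
    - by apply: cvg_at_right_filter; apply: cT; rewrite ax (le_trans (ltW xy) yb).
    - by apply: cvg_at_left_filter; apply: cT; rewrite yb (le_trans ax (ltW xy)).
  move=> z; rewrite in_itv/= => /andP[xz zy]; rewrite derive1E.
  apply: (@derive_val _ _ _ _ _ _ _ (dT z _)).
  by rewrite (le_trans ax (ltW xz)) (le_trans (ltW zy) yb).
move=> x y xy; split.
  apply: (@intR_S _ setT) => //; apply: intR_mkcond => //; exact: i0.
rewrite -Rintegral_mkcondr; cbv beta.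
have -> : `[x, y] `&` `[a, b] = `[Num.max x a, Num.min y b]%classic.
  apply/seteqP; split=> z /=; rewrite !in_itv/= ge_max le_min.
    by move=> [/andP[-> ->] /andP[-> ->]].
  by move=> /andP[/andP[-> ->] /andP[-> ->]].
have [xb|bx] := leP x b; last first.
  have -> : Num.min (Num.max x a) b = b.
    by apply/min_idPr; rewrite le_max (ltW bx).
  have -> : Num.min (Num.max y a) b = b.
    by apply/min_idPr; rewrite le_max (le_trans (ltW bx) xy).
  rewrite set_itv_ge ?Rintegral_set0 ?subrr// bnd_simp -ltNge.
  by rewrite gt_min lt_max; apply/orP; right; rewrite lt_max bx.
have [ya|ay] := ltP y a.
  have -> : Num.min (Num.max x a) b = a.
    by rewrite (max_idPr _) ?(min_idPl _)// (le_trans xy) ?ltW.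
  rewrite (min_idPl ab).
  rewrite set_itv_ge ?Rintegral_set0 ?subrr// bnd_simp -ltNge.
  by rewrite gt_min !lt_max ya orbT.
have -> : Num.min (Num.max x a) b = Num.max x a.
  by apply/min_idPl; rewrite ge_max xb.
apply: FTC; rewrite ?le_max ?ge_min ?lexx ?orbT//.
by rewrite ge_max !le_min xy ay xb ab.
Qed.

End Clip.

Section Arithmetic.
Context {R : realType}.
Implicit Types a b c m s : R.

Lemma below_half m s : 0 < m -> 0 < s -> s <= m / 2 ->
  (0 < s < m) && (0 < m - s < m).
Proof. by move=> *; apply/andP; split; apply/andP; split; lra. Qed.

Lemma half_lt_compl m s : s < m / 2 -> s < m - s.
Proof. lra. Qed.

Lemma half_le_compl m s : s <= m / 2 -> s <= m - s /\ s <= m - (m - s).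
Proof. by move=> ?; split; lra. Qed.

Lemma lt_subCr a b c : a < b - c -> c < b - a.
Proof. lra. Qed.

Lemma boundary_le a b c d e f : a <= f -> d <= c -> - c <= e ->
  a + b + (d - e) <= f + b + (c + c) .
Proof. lra. Qed.

End Arithmetic.

(** * The transport inequality, for the real and imaginary parts f1, f2 of u *)

Section Core.
Context {R : realType}.
Local Notation mu := (@lebesgue_measure R).
Local Notation intR A f := (mu.-integrable A (EFin \o f)).
Variables gamma omega : R.
Hypothesis gamma0 : 0 < gamma.
Local Notation p := (phi omega gamma).
Local Notation G := (cdf (fun x => p x ^+ 2)).
Local Notation mp := (\int[mu]_x (p x ^+ 2)).

Variables f1 f2 g1 g2 : R -> R.
Hypotheses (pf1 : primitive f1 g1) (pf2 : primitive f2 g2).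
Hypotheses (mg1 : measurable_fun setT g1) (mg2 : measurable_fun setT g2).
Let w x := f1 x ^+ 2 + f2 x ^+ 2.
Let D x := g1 x ^+ 2 + g2 x ^+ 2.
Let L x := w x * ln (w x).
Hypotheses (wi : intR setT w) (Di : intR setT D) (Li : intR setT L).
Let m := \int[mu]_x w x.
Let DD := \int[mu]_x D x.
Hypothesis m0 : 0 < m.
Let F := cdf w.
Let c := mp / m.

(** The derivative of [w]. *)
Definition crossterm x := 2 * (f1 x * g1 x + f2 x * g2 x).
Local Notation wp := crossterm.

Let mp0 : 0 < mp. Proof. exact: phi_mass_gt0. Qed.
Let c0 : 0 < c. Proof. by rewrite divr_gt0. Qed.
Let cf1 : continuous f1. Proof. exact: primitive_continuous pf1. Qed.
Let cf2 : continuous f2. Proof. exact: primitive_continuous pf2. Qed.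
Let mf1 : measurable_fun setT f1. Proof. exact: continuous_measurable_fun. Qed.
Let mf2 : measurable_fun setT f2. Proof. exact: continuous_measurable_fun. Qed.
Let w0 x : 0 <= w x. Proof. by rewrite addr_ge0 ?sqr_ge0. Qed.
Let D0 x : 0 <= D x. Proof. by rewrite addr_ge0 ?sqr_ge0. Qed.
Let cw : continuous w.
Proof. by apply: continuous_fD; exact: continuous_fsqr. Qed.

Let w_eq0 x : w x = 0 -> f1 x = 0 /\ f2 x = 0.
Proof.
move=> /eqP; rewrite paddr_eq0 ?sqr_ge0// => /andP[].
by rewrite !sqrf_eq0 => /eqP-> /eqP->.
Qed.

Let wp_meas : measurable_fun setT wp.
Proof.
by apply: measurable_funM => //; apply: measurable_funD; apply: measurable_funM.
Qed.

Lemma crossterm_primitive : primitive w wp.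
Proof.
have := primitive_D (primitive_M pf1 pf1) (primitive_M pf2 pf2).
rewrite (_ : (fun x => f1 x * f1 x + f2 x * f2 x) = w)//.
rewrite (_ : (fun x => _ + _) = wp)//; apply/funext => x; rewrite /crossterm; ring.
Qed.

(** Young's inequality with a free weight, later (n+2)^2: it is large enough to make the [D] term
    small, and the [w] term is integrated over a tail of mass m / (n+2)^4. *)
Lemma crossterm_le x l : 0 < l -> `|wp x| <= l * w x + l^-1 * D x.
Proof.
move=> l0.
have H (a b : R) : `|2 * (a * b)| <= l * a ^+ 2 + l^-1 * b ^+ 2.
  have e s : s ^+ 2 = 1 -> l * a ^+ 2 + l^-1 * b ^+ 2 - s * (2 * (a * b)) =
      l^-1 * (l * a - s * b) ^+ 2.
    move=> s1; rewrite [RHS](_ : _ = l^-1 * (l ^+ 2 * a ^+ 2 - 2 * l * a * s * b + s ^+ 2 * b ^+ 2)); last ring.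
    by rewrite s1; field; rewrite gt_eqF.
  rewrite ler_norml; apply/andP; split; rewrite -subr_ge0.
    have := e (-1); rewrite sqrrN expr1n mulN1r opprK => /(_ erefl) h.
    by rewrite opprK addrC h mulr_ge0 ?sqr_ge0 ?invr_ge0 ?ltW.
  have := e 1; rewrite expr1n mul1r => /(_ erefl) ->.
  by rewrite mulr_ge0 ?sqr_ge0 ?invr_ge0 ?ltW.
rewrite /crossterm mulrDr; apply: (le_trans (ler_normD _ _)).
apply: le_trans (lerD (H _ _) (H _ _)) _.
by rewrite le_eqVlt; apply/orP; left; apply/eqP; rewrite /w /D; ring.
Qed.

Let wpi : intR setT wp.
Proof.
apply: (@intR_le _ _ _ (fun x => 1 * w x + 1^-1 * D x)) => //.
  by move=> x _; exact: crossterm_le.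
by apply: intR_D => //; exact: intR_Z.
Qed.

Let tail_left x : \int[mu]_(t in `]-oo, x]) wp t = w x.
Proof. exact: primitive_tail_left crossterm_primitive wi wpi. Qed.
Let tail_right x : \int[mu]_(t in `[x, +oo[) wp t = - w x.
Proof. exact: primitive_tail_right crossterm_primitive wi wpi. Qed.

Let tail_bound (A : set R) x l : measurable A -> 0 < l ->
  w x <= `|\int[mu]_(t in A) wp t| ->
  w x <= l * \int[mu]_(t in A) w t + l^-1 * DD.
Proof.
move=> mA l0 h; apply: (le_trans h).
have iA : intR A wp by exact: intR_S wpi.
have wA : intR A w by exact: intR_S wi.
have DA : intR A D by exact: intR_S Di.
apply: le_trans (le_normr_Rintegral _ _) _ => //.
apply: (@le_trans _ _ (\int[mu]_(t in A) (l * w t + l^-1 * D t))).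
  apply: le_Rintegral => //; first exact: intR_norm.
    by apply: intR_D => //; exact: intR_Z.
  by move=> t _; exact: crossterm_le.
rewrite RintegralD//; [|exact: intR_Z..].
rewrite !RintegralZl// lerD2l ler_wpM2l ?invr_ge0 ?(ltW l0)// /DD.
by apply: Rint_le_subset.
Qed.

(** [w x] is the integral of w' over the left tail, so little mass in the tail forces a small
    density, at a rate set by l. [density_le_ccdf] is the mirror image. *)
Lemma density_le_cdf x l : 0 < l -> w x <= l * F x + l^-1 * DD.
Proof.
by move=> l0; apply: tail_bound => //; rewrite tail_left ler_norm.
Qed.

Lemma density_le_ccdf x l : 0 < l -> w x <= l * (m - F x) + l^-1 * DD.
Proof.
move=> l0; rewrite /F /m cdf_compl//; apply: tail_bound => //.
by rewrite tail_right normrN ler_norm.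
Qed.

(** Takes the default value 0 off the range of [G]; thus [transport] carries information only where
    0 < F < m. *)
Let Ginv s := xget 0 [set y | G y = s].
Let GinvK y : Ginv (G y) = y.
Proof.
have := @xgetPex _ 0 [set z | G z = G y]; rewrite /Ginv /= => H.
by apply: (@phi_cdf_inj _ gamma omega gamma0); apply: H; exists y.
Qed.

Definition transport x := Ginv (c * F x).
Definition transport' x := c * w x / p (transport x) ^+ 2.
Local Notation T := transport.
Local Notation T' := transport'.

Let inside x := 0 < F x < m.

Lemma cdf_transport x : inside x -> G (T x) = c * F x.
Proof.
move=> /andP[x1 x2].
have [||||y Hy] := @cdf_surj R (fun x => p x ^+ 2) _ _ _ (c * F x).
- exact: phi2_continuous.
- by move=> z; exact: sqr_ge0.
- exact: phi2_int.
- rewrite mulr_gt0//= /c -mulrA gtr_pMr// mulrC ltr_pdivrMr// mul1r //.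
have := @xgetPex _ 0 [set z | G z = c * F x]; apply; exists y.
exact: Hy.
Qed.

Let G_derive (y : R) : is_derive y 1 G (p y ^+ 2).
Proof. by apply: cdf_derive; [exact: phi2_continuous|exact: phi2_int]. Qed.

Let F_derive (y : R) : is_derive y 1 F (w y).
Proof. exact: cdf_derive. Qed.

(** Inverse function theorem at [T x], where the derivative phi^2 of [G] does not vanish. *)
Lemma transport_derive (x : R) : inside x -> is_derive x 1 T (T' x).
Proof.
move=> xin.
have p2 : p (T x) ^+ 2 != 0 by rewrite gt_eqF// phi2_gt0.
have cG : continuous G by exact: (is_derive_continuous G_derive).
have n1 : {near T x, cancel G Ginv} by apply: (@filterE _ _ (nbhs_filter (T x))) => y; exact: GinvK.
have n2 : {near T x, continuous G} by apply: (@filterE _ _ (nbhs_filter (T x))) => y; exact: cG.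
have dG := is_derive_inverse n1 n2 (G_derive (T x)) p2.
have dcF := is_derive_fM (is_derive_cst (c : R) x 1) (F_derive x).
rewrite (cdf_transport xin) in dG.
apply: is_derive_eq (@is_derive1_comp _ Ginv (fun x => c * F x) _ _ _ dG dcF) _.
by rewrite /transport' /= mul0r add0r mulrC.
Qed.

Let cF : continuous F. Proof. exact: (is_derive_continuous F_derive). Qed.

Lemma inside_near x : inside x -> \forall z \near x, inside z.
Proof.
move=> /andP[h1 h2].
have n1 : \forall z \near x, 0 < F z by exact: cvgr_gt (@cF x) _ h1.
have n2 : \forall z \near x, F z < m by exact: cvgr_lt (@cF x) _ h2.
by apply: filterS2 n1 n2 => z; rewrite /inside => -> ->.
Qed.

Let cT x : inside x -> {for x, continuous T}.
Proof.
move=> xin; apply: differentiable_continuous; apply/derivable1_diffP.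
exact: (@ex_derive _ _ _ _ _ _ _ (transport_derive xin)).
Qed.

Lemma transport'_continuous x : inside x -> {for x, continuous T'}.
Proof.
move=> xin; apply: cvgM.
  by apply: cvgMr; exact: cw.
apply: cvgV; first by rewrite gt_eqF// phi2_gt0.
have cp : continuous (fun x => p x ^+ 2) by exact: phi2_continuous.
by apply: (@continuous_comp _ _ _ T (fun x => p x ^+ 2)); [exact: cT|exact: cp].
Qed.

(** Kept apart from [deficit] because it is integrable on the whole line, whereas the derivative of
    T w is handled only on intervals [[a, b]] inside {0 < F < m}. *)
Definition remainder x := gamma / 2 * (Num.sg x * wp x) + (omega - ln c) * w x - L x.
Definition deficit x := D x + remainder x + (T' x * w x + T x * wp x).
(** The [q] of the overview. *)
Definition shift x := T x + Num.sg x * (gamma / 2).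

Lemma ln_sub1_le (t : R) : 0 < t -> ln t <= t - 1.
Proof. by move=> t0; rewrite -[t in ln t](addrNK 1) addrC; apply: le_ln1Dx; lra. Qed.

Lemma deficitE x : deficit x = (g1 x + shift x * f1 x) ^+ 2 +
  (g2 x + shift x * f2 x) ^+ 2 + w x * (T' x - 1 - ln (T' x)) +
  w x * (pot gamma (T x) - shift x ^+ 2).
Proof.
rewrite /deficit /remainder /L.
have [wx|wx] := eqVneq (w x) 0.
  have [e1 e2] := w_eq0 wx.
  by rewrite /crossterm wx e1 e2 /D; ring.
have wx0 : 0 < w x by rewrite lt_neqAle eq_sym wx w0.
(* The change of variables T' = c w / phi(T)^2 makes w ln T' supply the entropy, ln c and omega at
   once; the 1 here cancels the -1 in T' - 1 - ln T'. *)
have -> : ln (T' x) = ln c + ln (w x) - (omega + 1 - pot gamma (T x)).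
  have cwx : 0 < c * w x by apply: mulr_gt0.
  rewrite /transport' ln_div ?posrE ?phi2_gt0//.
  by rewrite lnM ?posrE// ln_phi_sqr.
by rewrite /crossterm /D /shift; set l := ln c; set l' := ln (w x); rewrite /w; field.
Qed.

(** Triangle inequality for T + sg x gamma/2, with gamma > 0. Its strict form [gap_pos] is what
    later fixes the position of the profile. *)
Lemma shift_sqr_le x : shift x ^+ 2 <= pot gamma (T x).
Proof.
rewrite /shift /pot -(real_normK (num_real (_ + _))).
apply: lerXn2r; rewrite ?nnegrE// ?addr_ge0// ?divr_ge0// ?(ltW gamma0)//.
apply: (le_trans (ler_normD _ _)); rewrite lerD2l normrM.
rewrite [X in _ * X]ger0_norm ?divr_ge0 ?(ltW gamma0)//.
rewrite ler_piMl ?divr_ge0 ?(ltW gamma0)// normr_sg.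
by case: (x != 0).
Qed.

Lemma transport_log_ge0 x : 0 <= w x * (T' x - 1 - ln (T' x)).
Proof.
have [->|wx] := eqVneq (w x) 0; first by rewrite mul0r.
rewrite mulr_ge0// subr_ge0 ln_sub1_le//.
by rewrite divr_gt0 ?phi2_gt0// mulr_gt0// lt_neqAle eq_sym wx w0.
Qed.

Lemma potential_gap_ge0 x : 0 <= w x * (pot gamma (T x) - shift x ^+ 2).
Proof. by rewrite mulr_ge0// subr_ge0 shift_sqr_le. Qed.

Lemma deficit_ge0 x : 0 <= deficit x.
Proof.
by rewrite deficitE !addr_ge0 ?sqr_ge0 ?transport_log_ge0 ?potential_gap_ge0.
Qed.

Let sgwp_int : intR setT (fun x => Num.sg x * wp x).
Proof. exact: intR_sgrM. Qed.

Lemma remainder_int : intR setT remainder.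
Proof.
apply: intR_B => //; apply: intR_D => //; first exact: intR_Z.
exact: intR_Z.
Qed.

Lemma Rint_remainder : DD + \int[mu]_x remainder x =
  DD + omega * m - gamma * w 0 - \int[mu]_x L x - m * ln c.
Proof.
rewrite /remainder RintegralB//; last first.
  by apply: intR_D => //; exact: intR_Z.
rewrite RintegralD//; [|exact: intR_Z..].
rewrite !RintegralZl// (primitive_Rint_sgr crossterm_primitive wi wpi).
by rewrite -/m; field.
Qed.

Lemma Rint_deficit a b : a <= b -> inside a -> inside b ->
  \int[mu]_(x in `[a, b]) deficit x =
  \int[mu]_(x in `[a, b]) D x + \int[mu]_(x in `[a, b]) remainder x +
  (T b * w b - T a * w a).
Proof.
move=> ab /andP[a1 a2] /andP[b1 b2].
have ins x : a <= x <= b -> inside x.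
  move=> /andP[ax xb]; apply/andP; split.
    by apply: (lt_le_trans a1); exact: cdf_homo.
  by apply: le_lt_trans b2; exact: cdf_homo.
have pc := primitive_clip ab (fun x h => transport_derive (ins x h))
  (fun x h => transport'_continuous (ins x h)).
pose Tc x := T (Num.min (Num.max x a) b).
have [i e0] := primitive_M pc crossterm_primitive ab; move: e0; rewrite -!/(Tc _).
have Tcx x : a <= x <= b -> Tc x = T x.
  by move=> /andP[ax xb]; rewrite /Tc (max_idPl ax) (min_idPl xb).
rewrite !Tcx ?lexx ?ab// => ->.
have e x : x \in `[a, b]%classic -> (T' \_ `[a, b]) x * w x + Tc x * wp x =
    T' x * w x + T x * wp x.
  move=> xab; rewrite patchE xab.
  by move: xab; rewrite inE/= in_itv/= => /Tcx ->.
have i2 : intR `[a, b] (fun x => T' x * w x + T x * wp x).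
  by apply: intR_eq i => // x /e.
have iD : intR `[a, b] D by exact: intR_S Di.
have iR : intR `[a, b] remainder by apply: intR_S remainder_int.
rewrite [X in _ = _ + X](_ : _ = \int[mu]_(x in `[a, b]) (T' x * w x + T x * wp x)); last first.
  by apply: eq_Rintegral => x /e.
by rewrite -RintegralD// -RintegralD//; exact: intR_D.
Qed.

Lemma deficit_int a b : a <= b -> inside a -> inside b ->
  intR `[a, b] deficit.
Proof.
move=> ab /andP[a1 a2] /andP[b1 b2].
have ins x : a <= x <= b -> inside x.
  move=> /andP[ax xb]; apply/andP; split.
    by apply: (lt_le_trans a1); exact: cdf_homo.
  by apply: le_lt_trans b2; exact: cdf_homo.
have pc := primitive_clip ab (fun x h => transport_derive (ins x h))
  (fun x h => transport'_continuous (ins x h)).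
have [i _] := primitive_M pc crossterm_primitive ab.
apply: intR_D => //.
  apply: intR_D => //; first exact: intR_S Di.
  by apply: intR_S remainder_int.
apply: intR_eq i => // x xab; rewrite patchE xab.
by move: xab; rewrite inE/= in_itv/= => /andP[ax xb]; rewrite (max_idPl ax) (min_idPl xb).
Qed.

(** The fourth power matches the fourth moment: at the level m / kk n, |T| is at most C (n+2), while
    the weight l = (n+2)^2 gives w <= (m + DD) / (n+2)^2, so T w is O(1/(n+2)). Starting at n+2
    keeps the two levels m / kk n and m - m / kk n distinct and ordered. *)
Let kk (n : nat) : R := n.+2%:R ^+ 4.
Let kk2 n : 2 <= kk n.
Proof.
have h : 2 <= n.+2%:R :> R by rewrite ler_nat.
by apply: (le_trans h); rewrite /kk ler_eXnr// ler1n.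
Qed.
Let kk0 n : 0 < kk n. Proof. exact: lt_le_trans (kk2 n). Qed.

Lemma exhaustion : exists a b : nat -> R, forall n,
  [/\ F (a n) = m / kk n, F (b n) = m - m / kk n, a n < b n,
      inside (a n) & inside (b n)].
Proof.
have lev n : 0 < m / kk n /\ m / kk n <= m / 2.
  split; first by rewrite divr_gt0.
  by rewrite ler_pM2l// lef_pV2 ?posrE.
have [a Ha] : {a : nat -> R & forall n, F (a n) = m / kk n}.
  apply: (@choice _ _ (fun n y => F y = m / kk n)) => n; apply: cdf_surj => //.
  by have [h1 h2] := lev n; rewrite -/m; have /andP[-> _] := below_half m0 h1 h2.
have [b Hb] : {b : nat -> R & forall n, F (b n) = m - m / kk n}.
  apply: (@choice _ _ (fun n y => F y = m - m / kk n)) => n; apply: cdf_surj => //.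
  by have [h1 h2] := lev n; rewrite -/m; have /andP[_ ->] := below_half m0 h1 h2.
exists a, b => n; have [h1 h2] := lev n.
have e4 : kk n > 2.
  by rewrite /kk; apply: (@lt_le_trans _ _ (2 ^+ 4)); [rewrite -natrX ltr_nat|
    apply: lerXn2r; rewrite ?nnegrE// ler_nat].
have h3 : m / kk n < m / 2 by rewrite ltr_pM2l// ltf_pV2 ?posrE.
split=> //.
- apply: (@cdf_lt _ w) => //; rewrite -/F Ha Hb; exact: half_lt_compl.
- by rewrite /inside Ha; have /andP[-> _] := below_half m0 h1 h2.
- by rewrite /inside Hb; have /andP[_ ->] := below_half m0 h1 h2.
Qed.

(** At these levels both tails of phi^2 beyond [T x] have mass at least mp / kk n, so [phi_tail]
    gives T^4 <= (M4 / mp) kk n. The constant 1 + M4 / mp replaces a fourth root, being below its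
    own fourth power. *)
Lemma transport_le x n : F x = m / kk n \/ F x = m - m / kk n ->
  `|T x| <= (1 + (\int[mu]_x (pot gamma x ^+ 2 * p x ^+ 2)) / mp) * n.+2%:R.
Proof.
set M4 := \int[mu]_x _ => Fx.
have M40 : 0 <= M4 by apply: Rintegral_ge0 => z _; rewrite mulr_ge0 ?sqr_ge0.
have lev : 0 < m / kk n /\ m / kk n <= m / 2.
  split; first by rewrite divr_gt0.
  by rewrite ler_pM2l// lef_pV2 ?posrE.
have xin : inside x.
  move: lev => [h1 h2]; have /andP[i1 i2] := below_half m0 h1 h2.
  by rewrite /inside; case: Fx => ->.
have s0 : 0 < mp / kk n by rewrite divr_gt0.
have s2 : mp / kk n <= mp / 2 by rewrite ler_pM2l// lef_pV2 ?posrE.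
have e1 : c * (m / kk n) = mp / kk n by rewrite /c; field; rewrite !gt_eqF.
have e2 : c * m = mp by rewrite /c divfK// gt_eqF.
have h : T x ^+ 4 * (mp / kk n) <= M4.
  have GT := cdf_transport xin.
  have := @phi_tail _ gamma omega gamma0 (T x) _ (ltW s0); rewrite GT.
  have [h1 h2] := half_le_compl s2.
  by case: Fx => ->; rewrite ?mulrBr e1 ?e2; apply.
have C1 : 1 <= 1 + M4 / mp by rewrite lerDl divr_ge0// ltW.
have n2 : 0 <= n.+2%:R :> R by [].
rewrite -(@ler_pXn2r _ 4)//; last first.
  by rewrite nnegrE mulr_ge0// (le_trans _ C1).
have -> : `|T x| ^+ 4 = T x ^+ 4 by rewrite !(exprM _ 2 2) real_normK ?num_real.
rewrite exprMn -/(kk n).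
have -> : T x ^+ 4 = T x ^+ 4 * (mp / kk n) / mp * kk n by field; rewrite !gt_eqF.
rewrite ler_pM2r//.
apply: (@le_trans _ _ (M4 / mp)); first by rewrite ler_pM2r ?invr_gt0.
apply: (@le_trans _ _ (1 + M4 / mp)); first by rewrite lerDr.
exact: ler_eXnr.
Qed.

(** Serves both the inequality, which uses only that 0 <= e n in the limit, and its equality case,
    which also needs the intervals. *)
Lemma core_limit : exists a b e : nat -> R,
  [/\ e n @[n --> \oo] --> DD + \int[mu]_x remainder x,
      forall n, 0 <= \int[mu]_(x in `[a n, b n]) deficit x <= e n &
      forall n, [/\ F (a n) = m / kk n, F (b n) = m - m / kk n, a n < b n,
        inside (a n) & inside (b n)]].
Proof.
have [a [b Hab]] := exhaustion.
exists a, b.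
pose C := 1 + (\int[mu]_x (pot gamma x ^+ 2 * p x ^+ 2)) / mp.
have C0 : 0 <= C.
  rewrite addr_ge0// divr_ge0 ?(ltW mp0)//; apply: Rintegral_ge0 => z _.
  by rewrite mulr_ge0 ?sqr_ge0.
have DD0 : 0 <= DD by exact: Rintegral_ge0.
(* The last summand bounds the two boundary terms T w, at a n and at b n. *)
exists (fun n => DD + \int[mu]_(x in `[a n, b n]) remainder x + 2 * (C * (m + DD)) * n.+2%:R^-1); split => //.
  rewrite -[X in _ --> X]addr0; apply: cvgD.
    apply: cvgD; first exact: cvg_cst.
    apply: cvg_Rint_sets => //; first exact: remainder_int.
    (* A point with nonzero remainder has w <> 0, hence lies strictly between the levels for large
       n. *)
    move=> x rx.
    have wx : w x != 0.
      apply: contra rx => /eqP wx; have [e1 e2] := w_eq0 wx.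
      by apply/eqP; rewrite /remainder /L /crossterm wx e1 e2; ring.
    have /andP[h1 h2] := cdf_interior cw w0 wi wx.
    have kkoo : \forall n \near \oo, m / kk n < Num.min (F x) (m - F x).
      near=> n.
      have mn : 0 < Num.min (F x) (m - F x) by rewrite lt_min h1 subr_gt0.
      rewrite ltr_pdivrMr// mulrC -ltr_pdivrMr//.
      apply: (@lt_le_trans _ _ n%:R); first by near: n; exact: nbhs_infty_gtr.
      have hn : n%:R <= n.+2%:R :> R by rewrite ler_nat; apply: leqW.
      by apply: (le_trans hn); rewrite /kk ler_eXnr// ler1n.
    near=> n; have [e1 e2 _ _ _] := Hab n.
    have : m / kk n < Num.min (F x) (m - F x) by near: n.
    rewrite lt_min => /andP[k1 k2] /=; rewrite in_itv/=.
    apply/andP; split; apply: ltW; apply: (@cdf_lt _ w) => //; rewrite -/F ?e1 ?e2//.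
    exact: lt_subCr.
  rewrite -[X in _ --> X](mulr0 (2 * (C * (m + DD)))); apply: cvgMr.
  have := @cvg_harmonic R; rewrite -(cvg_shiftS (@harmonic R)); exact.
move=> n; have [e1 e2 ab ia ib] := Hab n.
rewrite Rintegral_ge0; last by move=> x _; exact: deficit_ge0.
rewrite /= (Rint_deficit (ltW ab) ia ib).
have hD : \int[mu]_(x in `[a n, b n]) D x <= DD by apply: Rint_le_subset.
have n0 : 0 < n.+2%:R :> R by [].
have l0 : 0 < n.+2%:R ^+ 2 :> R by rewrite exprn_gt0.
have bnd x : F x = m / kk n \/ F x = m - m / kk n ->
    `|T x * w x| <= C * (m + DD) * n.+2%:R^-1.
  move=> Fx; have hT := transport_le Fx.
  have hw : w x <= (m + DD) * (n.+2%:R ^+ 2)^-1.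
    have -> : (m + DD) * (n.+2%:R ^+ 2)^-1 =
      n.+2%:R ^+ 2 * (m / kk n) + (n.+2%:R ^+ 2)^-1 * DD.
      by rewrite /kk; field; rewrite gt_eqF.
    case: Fx => Fx; first by rewrite -Fx; exact: density_le_cdf.
    have -> : m / kk n = m - F x by rewrite Fx; ring.
    exact: density_le_ccdf.
  rewrite normrM [`|w x|]ger0_norm//.
  have -> : C * (m + DD) * n.+2%:R^-1 =
      (C * n.+2%:R) * ((m + DD) * (n.+2%:R ^+ 2)^-1) by field; rewrite gt_eqF.
  exact: ler_pM.
have := bnd _ (or_introl e1); have := bnd _ (or_intror e2).
rewrite !ler_norml => /andP[_ hb] /andP[ha _].
have -> : 2 * (C * (m + DD)) * n.+2%:R^-1 =
  C * (m + DD) * n.+2%:R^-1 + C * (m + DD) * n.+2%:R^-1 by ring.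
exact: (boundary_le _ hD hb ha).
Unshelve. all: by end_near. Qed.

Lemma transport_inequality :
  m * ln c <= DD + omega * m - gamma * w 0 - \int[mu]_x L x.
Proof.
have [a [b [e [ce He _]]]] := core_limit.
rewrite -subr_ge0 -Rint_remainder.
apply: (cvgr_to_ge ce); apply: nearW => n; have /andP[h1 h2] := He n.
exact: le_trans h2.
Qed.

(** The intervals grow with n, so the integral over a fixed [[a n, b n]] is at most e N for all N >
    n, and e N now tends to 0. A nonnegative function with zero integral vanishes almost everywhere,
    and the intervals exhaust {0 < F < m}. *)
Lemma transport_equality :
  DD + omega * m - gamma * w 0 - \int[mu]_x L x = m * ln c ->
  {ae mu, forall x, inside x -> deficit x = 0}.
Proof.
move=> E.
have [a [b [e [ce He Hab]]]] := core_limit.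
rewrite Rint_remainder E subrr in ce.
have kklt n N : (n < N)%N -> m / kk N < m / kk n.
  move=> nN; rewrite ltr_pM2l// ltf_pV2 ?posrE// /kk.
  by apply: ltrXn2r; rewrite ?nnegrE// ltr_nat.
have z n : \int[mu]_(x in `[a n, b n]) deficit x = 0.
  apply/eqP; rewrite eq_le; apply/andP; split; last by have /andP[] := He n.
  apply: (cvgr_to_ge ce); near=> N.
  have nN : (n < N)%N by near: N; exact: nbhs_infty_gt.
  have [e1 e2 ab ia ib] := Hab n; have [e1' e2' ab' ia' ib'] := Hab N.
  have /andP[_ h] := He N; apply: le_trans h.
  have kl := kklt _ _ nN.
  apply: Rint_le_subset => //; last exact: deficit_ge0.
    apply: subset_itv; rewrite bnd_simp; apply: ltW; apply: (@cdf_lt _ w) => //;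
      rewrite -/F ?e1 ?e2 ?e1' ?e2'//.
    by rewrite ltrD2l ltrN2.
  by apply: deficit_int => //; exact: ltW.
have ae n : {ae mu, forall x, a n <= x <= b n -> deficit x = 0}.
  have [e1 e2 ab ia ib] := Hab n.
  have id := deficit_int (ltW ab) ia ib.
  have : (\int[mu]_(x in `[a n, b n]) `|(deficit x)%:E| = 0)%E.
    rewrite -[LHS]fineK; last first.
      by apply: integrable_fin_num => //; exact: (intR_norm _ id).
    congr EFin; rewrite -[RHS](z n); apply: eq_Rintegral => x _.
    by rewrite ger0_norm// deficit_ge0.
  move=> /ae_eq_integral_abs H.
  have {}H := H (measurable_itv _) (proj2 (measurable_EFinP _ _) (intR_measurable id)).
  by apply: ae_imp H => x h xab; have /= := h; rewrite in_itv/= => /(_ xab)[].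
have := ae_foralln ae; apply: ae_imp => x Hx /andP[h1 h2].
have mn : 0 < Num.min (F x) (m - F x) by rewrite lt_min h1 subr_gt0.
have [n hn] : exists n, m / kk n < Num.min (F x) (m - F x).
  exists (Num.bound (m / Num.min (F x) (m - F x))).
  rewrite ltr_pdivrMr// mulrC -ltr_pdivrMr//.
  set N := Num.bound _.
  have hN : m / Num.min (F x) (m - F x) < N%:R by apply: archi_boundP; rewrite divr_ge0// ltW.
  apply: (lt_le_trans hN).
  have hn : N%:R <= N.+2%:R :> R by rewrite ler_nat; apply: leqW.
  by apply: (le_trans hn); rewrite /kk ler_eXnr// ler1n.
have [e1 e2 ab ia ib] := Hab n.
move: hn; rewrite lt_min => /andP[k1 k2].
apply: (Hx n); apply/andP; split; apply: ltW; apply: (@cdf_lt _ w) => //; rewrite -/F ?e1 ?e2//.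
exact: lt_subCr.
Unshelve. all: by end_near. Qed.

Lemma ln_sub1_eq (t : R) : 0 < t -> ln t = t - 1 -> t = 1.
Proof.
move=> t0 e; apply/eqP; apply: contraT => t1.
have t1' : t - 1 != 0 by rewrite subr_eq0.
have := expR_gt1Dx t1'; rewrite -e lnK ?posrE// e addrC subrK ltxx.
by [].
Qed.

Let w_gt0 x : w x != 0 -> 0 < w x.
Proof. by move=> wx; rewrite lt_neqAle eq_sym wx w0. Qed.

Let w_near x : w x != 0 -> \forall z \near x, w z != 0.
Proof. by move=> wx; exact: (cvgr_neq0 _ (@cw x) wx). Qed.

Let inside_itv x y z : inside x -> inside y -> x <= z -> z <= y -> inside z.
Proof.
move=> /andP[x1 x2] /andP[y1 y2] xz zy; apply/andP; split.
  by apply: (lt_le_trans x1); exact: cdf_homo.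
by apply: le_lt_trans y2; exact: cdf_homo.
Qed.

Let T'_gt0 x : w x != 0 -> 0 < T' x.
Proof. by move=> /w_gt0 wx; rewrite divr_gt0 ?phi2_gt0//; exact: mulr_gt0. Qed.

Let T'_eq0 x : w x = 0 -> T' x = 0.
Proof. by move=> wx; rewrite /transport' wx mulr0 mul0r. Qed.

Let level_small s : 0 < s -> exists n, m / kk n < s.
Proof.
move=> s0; exists (Num.bound (m / s)).
rewrite ltr_pdivrMr// mulrC -ltr_pdivrMr//.
set N := Num.bound _.
have hN : m / s < N%:R by apply: archi_boundP; rewrite divr_ge0// ltW.
apply: (lt_le_trans hN).
have hn : N%:R <= N.+2%:R :> R by rewrite ler_nat; apply: leqW.
by apply: (le_trans hn); rewrite /kk ler_eXnr// ler1n.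
Qed.

(** * The equality case *)

Section Rigidity.
Hypothesis mass_eq : m = mp.
Hypothesis energy_eq : DD + omega * m - gamma * w 0 - \int[mu]_x L x = 0.

Let c1 : c = 1. Proof. by rewrite /c -mass_eq divff// gt_eqF. Qed.

Let terms0 : {ae mu, forall x, inside x ->
  [/\ w x * (T' x - 1 - ln (T' x)) = 0,
      w x * (pot gamma (T x) - shift x ^+ 2) = 0,
      g1 x + shift x * f1 x = 0 & g2 x + shift x * f2 x = 0]}.
Proof.
have E : DD + omega * m - gamma * w 0 - \int[mu]_x L x = m * ln c.
  by rewrite energy_eq c1 ln1 mulr0.
apply: ae_imp (transport_equality E) => x H xin; have := H xin.
rewrite deficitE => /eqP.
have a1 := transport_log_ge0 x; have a2 := potential_gap_ge0 x.
have a3 := sqr_ge0 (g1 x + shift x * f1 x).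
have a4 := sqr_ge0 (g2 x + shift x * f2 x).
rewrite paddr_eq0 ?addr_ge0// paddr_eq0 ?addr_ge0// paddr_eq0//.
by rewrite !sqrf_eq0 => /andP[/andP[/andP[/eqP-> /eqP->] /eqP->] /eqP->].
Qed.

(** The identity holds only almost everywhere, but [T'] is continuous: if T' x <> 1, the same
    persists near x, where [ae_dense] finds a point at which ln T' = T' - 1. *)
Let T'1 x : inside x -> w x != 0 -> T' x = 1.
Proof.
move=> xin wx; apply: contrapT => /eqP T1.
have nT : \forall z \near x, T' z - 1 != 0.
  have cc : T' z - 1 @[z --> x] --> T' x - 1.
    by apply: cvgB; [exact: transport'_continuous|exact: cvg_cst].
  by apply: (cvgr_neq0 _ cc); rewrite subr_eq0.
have nn : \forall z \near x, [/\ inside z, w z != 0 & T' z - 1 != 0].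
  by apply: filterS3 (inside_near xin) (w_near wx) nT => z.
have [y [yin wy Ty] /(_ yin)[/eqP h _ _ _]] := ae_dense terms0 nn.
move: h; rewrite mulf_eq0 (negbTE wy)/= subr_eq0 eq_sym => /eqP h.
by move: Ty; rewrite subr_eq0 (ln_sub1_eq (T'_gt0 wy) h) eqxx.
Qed.

Let gap_pos (t s : R) : s ^+ 2 = 1 -> s * t < 0 ->
  (t + s * (gamma / 2)) ^+ 2 < pot gamma t.
Proof.
move=> s1 st.
have e : t ^+ 2 = `|t| ^+ 2 by rewrite real_normK ?num_real.
rewrite -subr_gt0.
have -> : pot gamma t - (t + s * (gamma / 2)) ^+ 2 = gamma * (`|t| - s * t).
  have -> : (t + s * (gamma / 2)) ^+ 2 =
      t ^+ 2 + s * t * gamma + s ^+ 2 * (gamma / 2) ^+ 2 by field.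
  by rewrite s1 e /pot; field.
rewrite mulr_gt0// subr_gt0; apply: (lt_le_trans st); exact: normr_ge0.
Qed.

(** A map pointing against x would do so on a neighbourhood, where by [gap_pos] the potential gap is
    positive, while it vanishes almost everywhere. *)
Let sign x : inside x -> x != 0 -> w x != 0 -> 0 <= Num.sg x * T x.
Proof.
move=> xin x0 wx; rewrite leNgt; apply/negP => neg.
have nT : \forall z \near x, Num.sg x * T z < 0.
  have cc : Num.sg x * T z @[z --> x] --> Num.sg x * T x.
    by apply: cvgMr; exact: cT.
  exact: (cvgr_lt _ cc _ neg).
have nS : \forall z \near x, Num.sg z = Num.sg x.
  have [xn|xp] := ltP x 0.
    near=> z; have zn : z < 0 by near: z; exact: lt_nbhsl.
    by rewrite !ltr0_sg.
  have {}xp : 0 < x by rewrite lt_neqAle eq_sym x0.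
  near=> z; have zn : 0 < z by near: z; exact: lt_nbhsr.
  by rewrite !gtr0_sg.
have nn : \forall z \near x, [/\ inside z, w z != 0 & Num.sg x * T z < 0 /\ Num.sg z = Num.sg x].
  by apply: filterS3 (inside_near xin) (w_near wx) (filterI nT nS) => z.
have [y [yin wy [sT sy]] /(_ yin)[_ /eqP h _ _]] := ae_dense terms0 nn.
move: h; rewrite mulf_eq0 (negbTE wy)/= subr_eq0 => /eqP h.
have := @gap_pos (T y) (Num.sg x); rewrite sqr_sg x0 => /(_ erefl sT).
by rewrite -sy -/(shift y) h ltxx.
Unshelve. all: by end_near. Qed.

(** This excludes zeros of u inside: [T'] is 1 where w <> 0 and 0 where w = 0, it is continuous on
    the interval {0 < F < m}, and it equals 1 somewhere. A zero would force the value 1/2 in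
    between. *)
Let T'1_all x : inside x -> T' x = 1.
Proof.
move=> xin; apply: contrapT => T1.
have wx : w x = 0 by apply: contrapT => /eqP wx; apply: T1; exact: T'1.
have [a [b Hab]] := exhaustion; have [e1 e2 ab _ _] := Hab 0%N.
have [z1 wz1] : exists z, w z != 0.
  have [|z _ ez] := MVT ab (fun z _ => F_derive z); first exact: continuous_subspaceT.
  exists z; apply: contraT; rewrite negbK => /eqP wz.
  move: ez; rewrite wz mul0r => /eqP; rewrite subr_eq0 => /eqP ez.
  have lt : F (a 0%N) < F (b 0%N).
    rewrite e1 e2; apply: half_lt_compl; rewrite ltr_pM2l// ltf_pV2 ?posrE// /kk.
    apply: (@lt_le_trans _ _ (2 ^+ 4)); first by rewrite -natrX ltr_nat.
    by [].
  by rewrite ez ltxx in lt.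
have zin : inside z1 by apply: (cdf_interior cw w0 wi wz1).
have H u v : inside u -> inside v -> u <= v -> T' u != T' v -> T' u = 0 \/ T' u = 1 ->
    T' v = 0 \/ T' v = 1 -> False.
  move=> uin vin uv ne hu hv.
  have wc : {within `[u, v], continuous T'}.
    apply: continuous_in_subspaceT => z; rewrite inE/= in_itv/= => /andP[uz zv].
    by apply: transport'_continuous; exact: inside_itv uin vin uz zv.
  have [|z] := IVT (v := 2^-1) uv wc.
    have h0 : 0 <= 2^-1 :> R by rewrite invr_ge0.
    have h1 : 2^-1 <= 1 :> R by rewrite invf_le1// ler1n.
    by case: hu hv ne => [->|->] [->|->]; rewrite ?eqxx// ge_min le_max h0 h1 ?orbT.
  rewrite in_itv/= => /andP[uz zv] ez.
  have zin' : inside z by exact: inside_itv uin vin uz zv.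
  have [wz|wz] := eqVneq (w z) 0.
    have := T'_eq0 wz; rewrite ez => /eqP; by rewrite invr_eq0 (negbTE (lt0r_neq0 _)).
  have := T'1 zin' wz; rewrite ez => /eqP; rewrite invr_eq1 => /eqP h2.
  by have : 1 < 2 :> R; [rewrite ltr1n|rewrite h2 ltxx].
have Tx := T'_eq0 wx; have Tz := T'1 zin wz1.
have [xz|/ltW zx] := leP x z1.
  have ne : T' x != T' z1 by rewrite Tx Tz eq_sym oner_eq0.
  exact: (H x z1 xin zin xz ne (or_introl Tx) (or_intror Tz)).
have ne : T' z1 != T' x by rewrite Tx Tz oner_eq0.
exact: (H z1 x zin xin zx ne (or_intror Tz) (or_introl Tx)).
Qed.

Let T_shift x y : inside x -> inside y -> T y - T x = y - x.
Proof.
suff H u v : inside u -> inside v -> u < v -> T v - T u = v - u.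
  move=> xin yin; have [xy|yx|->] := ltgtP x y; [exact: H| |by rewrite !subrr].
  by rewrite -opprB H// opprB.
move=> uin vin uv.
have ins z : u <= z -> z <= v -> inside z by exact: inside_itv.
have [| |z zuv ->] := @MVT _ T T' u v uv.
- move=> z; rewrite in_itv/= => /andP[uz zv].
  by apply: transport_derive; apply: ins; exact: ltW.
- apply: continuous_in_subspaceT => z; rewrite inE/= in_itv/= => /andP[uz zv].
  by apply: cT; exact: ins.
move: zuv; rewrite in_itv/= => /andP[uz zv].
by rewrite T'1_all ?mul1r//; apply: ins; exact: ltW.
Qed.

(** On {0 < F < m} the map is a translation, and it sends a n and b n to points of [G]-mass m / kk n
    and mp - m / kk n, beyond any given t for large n. Translating t = y + T (a 0) - a 0 back places
    y between a n and b n. *)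
Let all_inside y : inside y.
Proof.
have [a [b Hab]] := exhaustion.
have [_ _ _ i0 _] := Hab 0%N.
pose t := y + (T (a 0%N) - a 0%N).
have Gin : 0 < G t < mp.
  apply: cdf_interior; [exact: phi2_continuous|by move=> z; exact: sqr_ge0|exact: phi2_int|].
  by rewrite gt_eqF ?phi2_gt0.
have /andP[Gt1 Gt2] := Gin.
have [n hn] : exists n, m / kk n < Num.min (G t) (mp - G t).
  by apply: level_small; rewrite lt_min Gt1 subr_gt0.
have [e1 e2 ab ia ib] := Hab n.
move: hn; rewrite lt_min => /andP[k1 k2].
have p20 z : 0 <= p z ^+ 2 by exact: sqr_ge0.
have cp2 := @phi2_continuous _ gamma omega.
have ip2 := @phi2_int _ gamma omega gamma0.
have Ta : T (a n) < t.
  by apply: (cdf_lt cp2 p20 ip2); rewrite (cdf_transport ia) c1 mul1r e1.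
have Tb : t < T (b n).
  apply: (cdf_lt cp2 p20 ip2); rewrite (cdf_transport ib) c1 mul1r e2 mass_eq.
  by move: k2; rewrite mass_eq; exact: lt_subCr.
have ha := T_shift i0 ia; have hb := T_shift i0 ib.
have Ea : a n + (T (a 0%N) - a 0%N) = T (a n) by rewrite addrCA -ha addrC subrK.
have Eb : b n + (T (a 0%N) - a 0%N) = T (b n) by rewrite addrCA -hb addrC subrK.
apply: (inside_itv ia ib); rewrite -(lerD2r (T (a 0%N) - a 0%N)).
  by rewrite Ea ltW.
by rewrite Eb ltW.
Qed.

Let w_neq0 x : w x != 0.
Proof.
apply/negP => /eqP wx; have := T'1_all (all_inside x).
by rewrite (T'_eq0 wx) => /eqP; rewrite eq_sym oner_eq0.
Qed.

Let T_id x : T x = x.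
Proof.
pose k := T 0.
have Tk z : T z = z + k.
  have := T_shift (all_inside 0) (all_inside z).
  by rewrite subr0 -/k => e; rewrite -[X in _ = X + k]e subrK.
suff k0 : k = 0 by rewrite Tk k0 addr0.
apply/eqP; apply: contraT => kn.
(* A translation by k sends -k/2 to k/2, of the opposite sign, which [sign] forbids unless k = 0. *)
have h0 : - (k / 2) != 0 by rewrite oppr_eq0 mulf_neq0// invr_eq0.
have := sign (all_inside _) h0 (w_neq0 _).
have -> : T (- (k / 2)) = k / 2 by rewrite Tk; field.
have [k0|k0|k0] := ltgtP k 0; last by rewrite k0 eqxx in kn.
- have kk' : k / 2 < 0 by rewrite pmulr_llt0// invr_gt0.
  by rewrite gtr0_sg ?oppr_gt0// mul1r leNgt kk'.
- have kk' : 0 < k / 2 by rewrite divr_gt0.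
  by rewrite ltr0_sg ?oppr_lt0// mulN1r oppr_ge0 leNgt kk'.
Qed.

Lemma rigid_modulus x : w x = p x ^+ 2.
Proof.
have := T'1_all (all_inside x); rewrite /transport' c1 mul1r T_id => h.
have p2 : p x ^+ 2 != 0 by rewrite gt_eqF ?phi2_gt0.
by rewrite -[LHS](divfK p2) h mul1r.
Qed.

(** The quotient f / phi has derivative (g + drift f) / phi, which is 0 almost everywhere. *)
Let component (f g : R -> R) : primitive f g -> measurable_fun setT g ->
  measurable_fun setT f -> {ae mu, forall x, g x + drift gamma x * f x = 0} ->
  forall x, f x = f 0 / p 0 * p x.
Proof.
move=> pf mg mf ae x.
have pp := primitive_M pf (@phi_inv_primitive _ gamma omega).
have mp1 : measurable_fun setT (fun x => (p x)^-1).
  apply: continuous_measurable_fun => z; apply: cvgV; last exact: phi_continuous.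
  by rewrite gt_eqF ?phi_gt0.
have e := @primitive_ae_cst _ _ _ _ pp _ 0 x.
rewrite e ?mulfVK ?gt_eqF ?phi_gt0//.
- apply: measurable_funD; apply: measurable_funM => //.
  by apply: measurable_funM => //; exact: measurable_drift.
- apply: ae_imp ae => z hz.
  by rewrite mulrA -mulrDl [f z * _]mulrC hz mul0r.
Qed.

Lemma rigidity : exists2 ab : R * R, ab.1 ^+ 2 + ab.2 ^+ 2 = 1 &
  forall x, f1 x = ab.1 * p x /\ f2 x = ab.2 * p x.
Proof.
exists (f1 0 / p 0, f2 0 / p 0) => /=.
  rewrite !expr_div_n -mulrDl -/(w 0) rigid_modulus divff//.
  by rewrite gt_eqF ?phi2_gt0.
have sd x : shift x = drift gamma x by rewrite /shift T_id.
move=> x; split.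
  apply: component pf1 _ _ _ x => //.
  by apply: ae_imp terms0 => z /(_ (all_inside z))[_ _]; rewrite sd.
apply: component pf2 _ _ _ x => //.
by apply: ae_imp terms0 => z /(_ (all_inside z))[_ _ _]; rewrite sd.
Qed.

End Rigidity.

End Core.

(** * Complex-valued functions and the minimization problem *)

Section ComplexFunctions.
Context {R : realType}.
Local Notation mu := (@lebesgue_measure R).
Local Notation intR A f := (mu.-integrable A (EFin \o f)).
Local Notation Re := complex.Re.
Local Notation Im := complex.Im.
Implicit Types (u v h : R -> R[i]) (z t : R[i]).

Lemma ReMc z t : Re (z * t) = Re z * Re t - Im z * Im t.
Proof. by case: z => a b; case: t. Qed.

Lemma ImMc z t : Im (z * t) = Re z * Im t + Im z * Re t.
Proof. by case: z => a b; case: t. Qed.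

Lemma normc_sqrE z : normc z ^+ 2 = Re z ^+ 2 + Im z ^+ 2.
Proof. by case: z => a b /=; rewrite sqr_sqrtr// addr_ge0 ?sqr_ge0. Qed.

Definition sqmod u x : R := Re (u x) ^+ 2 + Im (u x) ^+ 2.

Lemma sqmod_ge0 u x : 0 <= sqmod u x.
Proof. by rewrite addr_ge0 ?sqr_ge0. Qed.

Lemma sqmod_measurable u : cmeasurable u -> measurable_fun setT (sqmod u).
Proof.
by move=> [mr mi]; apply: measurable_funD; apply: measurable_funX.
Qed.

Lemma L2enormE u : L2enorm u = ((\int[mu]_x (sqmod u x)%:E) `^ 2^-1)%E.
Proof.
rewrite /L2enorm unlock; congr poweR; apply: eq_integral => x _ /=.
rewrite /sqmod -normc_sqrE ger0_norm; last by case: (u x) => a b /=; exact: sqrtr_ge0.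
by rewrite powR_mulrn//; case: (u x) => a b /=; exact: sqrtr_ge0.
Qed.

Lemma L2_int u : L2 u -> intR setT (sqmod u).
Proof.
move=> [mu_ uoo]; apply/integrableP; split.
  by apply/measurable_EFinP; exact: sqmod_measurable.
under eq_integral do rewrite /= ger0_norm ?sqmod_ge0//.
by apply: (@lty_poweRy _ _ 2^-1); rewrite ?invr_eq0// -L2enormE.
Qed.

Lemma int_L2 u : cmeasurable u -> intR setT (sqmod u) -> L2 u.
Proof.
move=> mu_ /integrableP[_ i]; split => //; rewrite L2enormE poweR_lty//.
by move: i; under eq_integral do rewrite /= ger0_norm ?sqmod_ge0//.
Qed.

Lemma L2norm_sqr u : L2 u -> L2norm u ^+ 2 = \int[mu]_x sqmod u x.
Proof.
move=> /L2_int i; rewrite /L2norm L2enormE.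
have fin : (\int[mu]_x (sqmod u x)%:E)%E \is a fin_num by exact: integrable_fin_num.
rewrite -(fineK fin) -/(Rintegral mu setT (sqmod u)) poweR_EFin /=.
rewrite -powR_mulrn ?powR_ge0// -powRrM mulVf// powRr1//.
by apply: Rintegral_ge0 => x _; exact: sqmod_ge0.
Qed.

Lemma intR_of_sqr (f : R -> R) : measurable_fun setT f ->
  intR setT (fun x => f x ^+ 2) -> forall a b, intR `[a, b] f.
Proof.
move=> mf fi a b.
apply: (@intR_le _ _ _ (fun x => 1 + f x ^+ 2)) => //; first exact: measurable_funTS.
  move=> x _; rewrite -(real_normK (num_real (f x))).
  have := sqr_ge0 (`|f x| - 2^-1); rewrite sqrrB; set y := `|f x|; lra.
apply: intR_D => //; first by apply: continuous_intR; exact: continuous_fcst.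
exact: intR_S fi.
Qed.

Lemma intR_prod (f g : R -> R) : measurable_fun setT f -> measurable_fun setT g ->
  intR setT (fun x => f x ^+ 2) -> intR setT (fun x => g x ^+ 2) ->
  intR setT (fun x => f x * g x).
Proof.
move=> mf mg fi gi; apply: (@intR_le _ _ _ (fun x => f x ^+ 2 + g x ^+ 2)) => //.
- exact: measurable_funM.
- move=> x _; rewrite normrM -(real_normK (num_real (f x))) -(real_normK (num_real (g x))).
  have a0 := normr_ge0 (f x); have b0 := normr_ge0 (g x).
  have := sqr_ge0 (`|f x| - `|g x|); have ab0 := mulr_ge0 a0 b0.
  move: ab0; rewrite sqrrB -mulr_natr; set a := `|f x|; set b := `|g x|; lra.
- exact: intR_D.
Qed.

Lemma L2_components u : L2 u -> [/\ measurable_fun setT (fun x => Re (u x)),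
  measurable_fun setT (fun x => Im (u x)),
  intR setT (fun x => Re (u x) ^+ 2) & intR setT (fun x => Im (u x) ^+ 2)].
Proof.
move=> Lu; have i := L2_int Lu; have [[mr mi] _] := Lu; split => //.
- apply: intR_le i => //; first exact: measurable_funX.
  by move=> x _; rewrite ger0_norm ?sqr_ge0// lerDl sqr_ge0.
- apply: intR_le i => //; first exact: measurable_funX.
  by move=> x _; rewrite ger0_norm ?sqr_ge0// lerDr sqr_ge0.
Qed.

Lemma dxP u : H1 u -> L2 (dx u) /\ weak_derivative u (dx u).
Proof.
move=> [_ [v Hv]].
by have := @xgetPex _ (fun=> 0) [set v | L2 v /\ weak_derivative u v]; apply; exists v.
Qed.

(** Test functions are real-valued, so the real and imaginary parts of the weak identity separate
    and [distributional_primitive] applies to each. *)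
Lemma weak_derivative_primitive u v : ccontinuous u -> L2 v ->
  weak_derivative u v ->
  primitive (fun x => Re (u x)) (fun x => Re (v x)) /\
  primitive (fun x => Im (u x)) (fun x => Im (v x)).
Proof.
move=> [cr ci] Lv uv; have [mr mi ir ii] := L2_components Lv.
split; apply: distributional_primitive => //; try exact: intR_of_sqr.
- move=> psi tpsi; have := congr1 (@complex.Re R) (uv psi tpsi).
  rewrite /cintegral /= => H; have := H.
  under eq_Rintegral do rewrite ReMc /= mulr0 subr0.
  by under [X in _ = - X -> _]eq_Rintegral do rewrite ReMc /= mulr0 subr0.
- move=> psi tpsi; have := congr1 (@complex.Im R) (uv psi tpsi).
  rewrite /cintegral /= => H; have := H.
  under eq_Rintegral do rewrite ImMc /= mulr0 add0r.
  by under [X in _ = - X -> _]eq_Rintegral do rewrite ImMc /= mulr0 add0r.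
Qed.

Lemma sqlogE u x : sqlog u x = sqmod u x * ln (sqmod u x).
Proof. by rewrite /sqlog normc_sqrE. Qed.

Lemma nehariE omega gamma u : W u -> nehari omega gamma u =
  \int[mu]_x sqmod (dx u) x + omega * \int[mu]_x sqmod u x
  - gamma * sqmod u 0 - \int[mu]_x (sqmod u x * ln (sqmod u x)).
Proof.
move=> [_ [Hu _]]; have [Ldu _] := dxP Hu; have [Lu _] := Hu.
rewrite /nehari !L2norm_sqr// normc_sqrE; congr (_ - _).
by apply: eq_Rintegral => x _; rewrite sqlogE.
Qed.

Lemma actionE omega gamma u : W u -> action omega gamma u =
  2^-1 * nehari omega gamma u + 2^-1 * \int[mu]_x sqmod u x.
Proof.
by move=> [_ [[Lu _] _]]; rewrite /action /nehari -(L2norm_sqr Lu); field.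
Qed.

Lemma sqmod_int u : W u -> intR setT (sqmod u).
Proof. by move=> [_ [[Lu _] _]]; exact: L2_int. Qed.

Lemma sqmod_continuous u : W u -> continuous (sqmod u).
Proof.
by move=> [[cr ci] _]; apply: continuous_fD; exact: continuous_fsqr.
Qed.

(** Elements of [W] are continuous, so one nonzero value already produces mass, through
    [cdf_interior]. *)
Lemma W_mass_gt0 u : W u -> u <> (fun=> 0) -> 0 < \int[mu]_x sqmod u x.
Proof.
move=> Wu un0.
have [x ux] : exists x, sqmod u x != 0.
  apply: contrapT => H; apply: un0; apply/funext => x.
  have /eqP : sqmod u x == 0 by apply: contraT => ux; case: H; exists x.
  move=> /eqP; rewrite paddr_eq0 ?sqr_ge0// !sqrf_eq0 => /andP[/eqP h1 /eqP h2].
  by case: (u x) h1 h2 => a b /= -> ->.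
have /andP[h1 h2] := cdf_interior (sqmod_continuous Wu) (sqmod_ge0 u) (sqmod_int Wu) ux.
exact: lt_trans h1 h2.
Qed.

Lemma W_inequality omega gamma u : 0 < gamma -> W u -> u <> (fun=> 0) ->
  (\int[mu]_x sqmod u x) *
    ln ((\int[mu]_x (phi omega gamma x ^+ 2)) / (\int[mu]_x sqmod u x)) <=
  nehari omega gamma u.
Proof.
move=> g0 Wu un0; have m0 := W_mass_gt0 Wu un0; rewrite nehariE//.
have [cu [Hu Lu]] := Wu; have [Ldu wdu] := dxP Hu.
have [p1 p2] := weak_derivative_primitive cu Ldu wdu.
have [[mr mi] _] := Ldu.
apply: (transport_inequality omega g0 p1 p2 mr mi (sqmod_int Wu) (L2_int Ldu) _ m0).
by apply: intR_eq Lu => // x _; exact: sqlogE.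
Qed.

Lemma W_rigidity omega gamma u : 0 < gamma -> W u -> u <> (fun=> 0) ->
  nehari omega gamma u = 0 ->
  \int[mu]_x sqmod u x = \int[mu]_x (phi omega gamma x ^+ 2) ->
  exists2 ab : R * R, ab.1 ^+ 2 + ab.2 ^+ 2 = 1 &
  forall x, u x = (ab.1 +i* ab.2) * (phi omega gamma x)%:C.
Proof.
move=> g0 Wu un0 + meq; have m0 := W_mass_gt0 Wu un0; rewrite nehariE// => Nu.
have [cu [Hu Lu]] := Wu; have [Ldu wdu] := dxP Hu.
have [p1 p2] := weak_derivative_primitive cu Ldu wdu.
have [[mr mi] _] := Ldu.
have [|[a b] /= ab Hab] :=
  rigidity g0 p1 p2 mr mi (sqmod_int Wu) (L2_int Ldu) _ m0 meq Nu.
  by apply: intR_eq Lu => // x _; exact: sqlogE.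
exists (a, b) => // x; have [/= e1 e2] := Hab x.
case: (u x) e1 e2 => c d /= -> ->.
by apply/eqP; rewrite eq_complex /= !mulr0 subr0 add0r !eqxx.
Qed.

Lemma expi_surj (a b : R) : a ^+ 2 + b ^+ 2 = 1 -> exists th, a +i* b = expi th.
Proof.
move=> ab.
have b2 : b ^+ 2 = 1 - a ^+ 2 by rewrite -ab addrAC subrr add0r.
have a1 : -1 <= a <= 1.
  rewrite -ler_norml -(@ler_pXn2r _ 2)// ?nnegrE// real_normK ?num_real// expr1n -ab.
  by rewrite lerDl sqr_ge0.
have [_ ca] := acos_def a1; have sa := sin_acos a1.
rewrite -b2 sqrtr_sqr in sa.
have [b0|b0] := leP 0 b.
  by exists (acos a); rewrite /expi ca sa ger0_norm.
by exists (- acos a); rewrite /expi cosN sinN ca sa ltr0_norm// opprK.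
Qed.

End ComplexFunctions.

(** * Integration by parts against test functions, the converse of [distributional_primitive] *)

Section TestFunctions.
Context {R : realType}.
Local Notation mu := (@lebesgue_measure R).
Local Notation intR A f := (mu.-integrable A (EFin \o f)).

Lemma intR_support (f : R -> R) a b : intR `[a, b] f ->
  (forall x, ~ `[a, b]%classic x -> f x = 0) -> intR setT f.
Proof.
move=> fi f0; apply: intR_eq (intR_mkcond _ fi) => // x _; rewrite patchE.
by case: ifPn => // /negP; rewrite inE => /f0.
Qed.

Lemma test_function_primitive (psi : R -> R) : test_function psi ->
  [/\ primitive psi (derive1 psi), continuous psi & continuous (derive1 psi)].
Proof.
move=> [dpsi _].
have d0 (x : R) : is_derive x 1 psi (derive1 psi x).
  by rewrite derive1E; apply: DeriveDef => //; exact: (dpsi 0%N x).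
have c1 : continuous (derive1 psi).
  move=> x; apply: differentiable_continuous; apply/derivable1_diffP.
  exact: (dpsi 1%N x).
by split => //; [exact: derive_primitive|exact: is_derive_continuous d0].
Qed.

Lemma test_function_support (psi : R -> R) : test_function psi ->
  exists M, forall x, ~ `[- M, M]%classic x -> psi x = 0 /\ derive1 psi x = 0.
Proof.
move=> [_ /compact_bounded[M [Mr HM]]]; exists (M + 1) => x /=.
have out z : M + 1 < `|z| -> psi z = 0.
  move=> zM; apply/eqP; apply: contraT => pz.
  have : `|z| <= M + 1.
    by apply: (HM (M + 1)); [rewrite ltrDl|apply: subset_closure].
  by rewrite leNgt zM.
rewrite in_itv/= -ler_norml => /negP; rewrite -ltNge => xM; split; first exact: out.
have d0 : is_derive x 1 psi 0.
  apply: (@is_derive_near_eq _ (cst 0)).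
  have cn : `|z| @[z --> x] --> `|x| by exact: continuous_absr.
  have : \forall z \near x, M + 1 < `|z| by exact: cvgr_gt cn _ xM.
  by apply: filterS => z /out ->.
by rewrite derive1E (@derive_val _ _ _ _ _ _ _ d0).
Qed.

Lemma primitive_weak (f g psi : R -> R) : primitive f g -> test_function psi ->
  \int[mu]_x (f x * derive1 psi x) = - \int[mu]_x (g x * psi x).
Proof.
move=> pfg tpsi; have [pp cpsi cdpsi] := test_function_primitive tpsi.
have [M HM] := test_function_support tpsi.
have cf := primitive_continuous pfg.
(* If M < 0 the segment is empty and psi vanishes identically. *)
have [M0|M0] := leP (- M) M; last first.
  have H x : psi x = 0 /\ derive1 psi x = 0.
    by apply: HM => /=; rewrite in_itv/= => /andP[h1 h2]; move: (le_trans h1 h2); rewrite leNgt M0.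
  under eq_Rintegral do rewrite (H _).2 mulr0.
  under [X in _ = - X]eq_Rintegral do rewrite (H _).1 mulr0.
  by rewrite /Rintegral integral0 oppr0.
have i1 : intR setT (fun x => f x * derive1 psi x).
  apply: (@intR_support _ (- M) M); first by apply: continuous_intR; exact: continuous_fM.
  by move=> x /HM[_ ->]; rewrite mulr0.
have i2 : intR setT (fun x => g x * psi x).
  apply: (@intR_support _ (- M) M); last by move=> x /HM[-> _]; rewrite mulr0.
  apply: (@intR_eq _ _ (fun x => psi x * g x)) => //; first by move=> x _; rewrite mulrC.
  by apply: intR_contM => //; exact: (pfg _ _ M0).1.
have i3 : intR setT (fun x => f x * psi x).
  apply: (@intR_support _ (- M) M); first by apply: continuous_intR; exact: continuous_fM.
  by move=> x /HM[-> _]; rewrite mulr0.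
have := primitive_Rint0 (primitive_M pfg pp) i3 (intR_D measurableT i2 i1).
by rewrite RintegralD// => /eqP; rewrite addrC addr_eq0 => /eqP.
Qed.

End TestFunctions.

(** * The profile belongs to [W] and solves the stationary equation *)

Section Soliton.
Context {R : realType}.
Local Notation mu := (@lebesgue_measure R).
Local Notation intR A f := (mu.-integrable A (EFin \o f)).
Local Notation Re := complex.Re.
Local Notation Im := complex.Im.
Variables gamma omega : R.
Hypothesis gamma0 : 0 < gamma.
Local Notation p := (phi omega gamma).
Local Notation pot := (pot gamma).
Local Notation drift := (drift gamma).

(** All multipliers of the weak equation (1, x, sg, drift, pot and the products that occur) are at
    most 1 + pot in absolute value, so this single moment bound makes every integral finite. *)
Lemma poly_phi_int (q : R -> R) : measurable_fun setT q ->
  (forall x, `|q x| <= 1 + pot x) -> intR setT (fun x => (q x * p x) ^+ 2).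
Proof.
move=> mq hq.
have mp : measurable_fun setT p by apply: continuous_measurable_fun; exact: phi_continuous.
apply: (@intR_le _ _ _ (fun x => p x ^+ 2 + 2 * (pot x * p x ^+ 2) + pot x ^+ 2 * p x ^+ 2)) => //.
- by apply: measurable_funX; exact: measurable_funM.
- move=> x _; rewrite ger0_norm ?sqr_ge0// exprMn.
  have -> : p x ^+ 2 + 2 * (pot x * p x ^+ 2) + pot x ^+ 2 * p x ^+ 2 =
      (1 + pot x) ^+ 2 * p x ^+ 2 by ring.
  rewrite ler_wpM2r ?sqr_ge0// -(real_normK (num_real (q x))).
  by apply: lerXn2r; rewrite ?nnegrE// addr_ge0 ?pot_ge0.
- apply: intR_D => //; last exact: pot2_phi2_int.
  apply: intR_D => //; first exact: phi2_int.
  by apply: intR_Z => //; exact: pot_phi2_int.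
Qed.

Lemma le_1pot (y x : R) : y ^+ 2 <= pot x -> `|y| <= 1 + pot x.
Proof.
move=> h; rewrite -(real_normK (num_real y)) in h.
have := sqr_ge0 (`|y| - 2^-1); rewrite sqrrB; move: h; set a := `|y|; lra.
Qed.

Lemma drift_le x : `|drift x| <= 1 + pot x.
Proof. by apply: le_1pot; exact: drift_sqr_le. Qed.

Section WeakEquation.
Variables H K : R -> R.
Hypotheses (pHK : primitive H K) (mK : measurable_fun setT K).
Hypotheses (iH : intR setT (fun x => H x ^+ 2)) (iK : intR setT (fun x => K x ^+ 2)).

Let mH : measurable_fun setT H.
Proof. by apply: continuous_measurable_fun; exact: primitive_continuous pHK. Qed.

Let mp : measurable_fun setT p.
Proof. by apply: continuous_measurable_fun; exact: phi_continuous. Qed.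

Let prod_int (q f : R -> R) : measurable_fun setT q ->
  (forall x, `|q x| <= 1 + pot x) -> measurable_fun setT f ->
  intR setT (fun x => f x ^+ 2) -> intR setT (fun x => q x * p x * f x).
Proof.
move=> mq hq mf fi; apply: intR_prod => //; first exact: measurable_funM.
exact: poly_phi_int.
Qed.

(* The jump of [drift] at [0] produces the delta term: the regular part
   [x * phi] is differentiated on the whole line, the [sg] part through
   [primitive_Rint_sgr]. *)
Lemma phi_weak_equation :
  \int[mu]_x (- drift x * p x * K x) + omega * \int[mu]_x (p x * H x)
  - \int[mu]_x (p x * (omega + 1 - pot x) * H x) - gamma * (p 0 * H 0) = 0.
Proof.
have md := @measurable_drift _ gamma.
have mpot : measurable_fun setT pot.
  by apply: continuous_measurable_fun; exact: pot_continuous.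
have hx x : `|x| <= 1 + pot x by apply: le_1pot; exact: sqr_le_pot.
have h1 (x : R) : `|1 : R| <= 1 + pot x by rewrite normr1 lerDl pot_ge0.
have hsg (x : R) : `|Num.sg x| <= 1 + pot x.
  by rewrite normr_sg; apply: le_trans (h1 x); rewrite normr1; case: (x != 0).
have hpot x : `|pot x| <= 1 + pot x by rewrite ger0_norm ?pot_ge0// lerDr.
have hxd x : `|x * drift x| <= 1 + pot x.
  apply: (@le_trans _ _ (pot x)); last by rewrite lerDr.
  rewrite normrM.
  have a := sqr_le_pot gamma0 x; have b := drift_sqr_le gamma x.
  rewrite -(real_normK (num_real x)) in a.
  rewrite -(real_normK (num_real (drift x))) in b.
  have := sqr_ge0 (`|x| - `|drift x|); rewrite sqrrB -mulr_natr.
  move: a b; set s := `|x|; set t := `|drift x|; lra.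
have hd2 x : `|drift x ^+ 2| <= 1 + pot x.
  rewrite ger0_norm ?sqr_ge0//; apply: le_trans (drift_sqr_le _ _) _.
  by rewrite lerDr.
have hsd x : `|Num.sg x * drift x| <= 1 + pot x.
  rewrite normrM normr_sg; apply: le_trans (drift_le x).
  by case: (x != 0); rewrite ?mul1r ?mul0r.
have ms := @measurable_sgr R.
have pf_int (f : R -> R) : measurable_fun setT f -> intR setT (fun x => f x ^+ 2) ->
    intR setT (fun x => p x * f x).
  move=> mf fi; have := @prod_int (fun=> 1) f (measurable_cst _) h1 mf fi.
  by apply: intR_eq => // x _; rewrite mul1r.
have iH1 := pf_int _ mH iH; have iK1 := pf_int _ mK iK.
have mid : measurable_fun setT (fun x : R => x) by exact: measurable_id.
have ixH := @prod_int _ H mid hx mH iH.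
have ixK := @prod_int _ K mid hx mK iK.
have idH := @prod_int _ H md drift_le mH iH.
have ixdH : intR setT (fun x => x * drift x * p x * H x).
  exact: (@prod_int _ H (measurable_funM mid md) hxd mH iH).
have isdH : intR setT (fun x => Num.sg x * drift x * p x * H x).
  exact: (@prod_int _ H (measurable_funM ms md) hsd mH iH).
have isK := @prod_int _ K ms hsg mK iK.
have id2H : intR setT (fun x => drift x ^+ 2 * p x * H x).
  exact: (@prod_int _ H (measurable_funX 2 md) hd2 mH iH).
have ipotH := @prod_int _ H mpot hpot mH iH.
have pphi := @phi_primitive _ gamma omega.
have pid : primitive (fun x : R => x) (fun=> 1).
  by apply: derive_primitive; exact: continuous_fcst.
have pphiH := primitive_M pphi pHK.
have pxphiH := primitive_M (primitive_M pid pphi) pHK.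
(* [A] integrates the derivative of phi H against sg and yields the point value; [B] integrates the
   derivative of x phi H and yields none. [C1] to [C4] split [drift] into x + sg gamma/2 so that
   only these integrals remain. *)
have A : \int[mu]_x (Num.sg x * (- drift x * p x * H x + p x * K x)) = - 2 * (p 0 * H 0).
  apply: (primitive_Rint_sgr pphiH iH1).
  apply: intR_D => //; apply: intR_eq (intR_Z (-1) measurableT idH) => // x _; ring.
have B : \int[mu]_x ((1 * p x + x * (- drift x * p x)) * H x + x * p x * K x) = 0.
  apply: (primitive_Rint0 pxphiH) => //.
  apply: intR_D => //.
  have i := intR_B measurableT iH1 ixdH.
  by apply: intR_eq i => // x _; ring.
have A' : \int[mu]_x (Num.sg x * p x * K x) -
    \int[mu]_x (Num.sg x * drift x * p x * H x) = - 2 * (p 0 * H 0).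
  by rewrite -A -RintegralB//; apply: eq_Rintegral => x _; ring.
have B' : \int[mu]_x (p x * H x) - \int[mu]_x (x * drift x * p x * H x) +
    \int[mu]_x (x * p x * K x) = 0.
  rewrite -B -RintegralB// -RintegralD//; last exact: intR_B.
  apply: eq_Rintegral => x _; ring.
have C1 : \int[mu]_x (- drift x * p x * K x) =
    (-1) * \int[mu]_x (x * p x * K x) - gamma / 2 * \int[mu]_x (Num.sg x * p x * K x).
  rewrite -!RintegralZl// -RintegralB//; [|exact: intR_Z..].
  by apply: eq_Rintegral => x _; rewrite /drift; ring.
have C2 : \int[mu]_x (drift x ^+ 2 * p x * H x) =
    \int[mu]_x (x * drift x * p x * H x) +
    gamma / 2 * \int[mu]_x (Num.sg x * drift x * p x * H x).
  rewrite -RintegralZl// -RintegralD//; last exact: intR_Z.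
  by apply: eq_Rintegral => x _; rewrite /drift; ring.
(* drift^2 and pot differ only at 0, a null set. *)
have C3 : \int[mu]_x (drift x ^+ 2 * p x * H x) = \int[mu]_x (pot x * p x * H x).
  apply: Rint_ae_eq => //; [exact: intR_measurable|exact: intR_measurable|].
  exists [set 0]; split => //; first exact: lebesgue_measure_set1.
  move=> x /= hn; apply: contrapT => x0; apply: hn => _.
  by rewrite drift_sqr//; apply/eqP.
have C4 : \int[mu]_x (p x * (omega + 1 - pot x) * H x) =
    (omega + 1) * \int[mu]_x (p x * H x) - \int[mu]_x (pot x * p x * H x).
  rewrite -RintegralZl// -RintegralB//; last exact: intR_Z.
  by apply: eq_Rintegral => x _; ring.
rewrite C1 C4 -C3 C2.
(* What is left is linear in six numbers: [B'] eliminates k1, [A'] eliminates k2. *)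
move: A' B'.
move: (\int[mu]_x (x * p x * K x)) (\int[mu]_x (Num.sg x * p x * K x))
  (\int[mu]_x (p x * H x)) (\int[mu]_x (x * drift x * p x * H x))
  (\int[mu]_x (Num.sg x * drift x * p x * H x)) (p 0 * H 0) => k1 k2 k3 k4 k5 k6 e1 e2.
have -> : k1 = k4 - k3.
  by apply/eqP; rewrite -subr_eq0 opprB -[X in _ == X]e2; apply/eqP; ring.
have -> : k2 = k5 - 2 * k6.
  by rewrite -[- (2 * k6)]mulNr -e1; ring.
by field.
Qed.

End WeakEquation.

Let ReMr (z : R[i]) (c : R) : Re (z * c%:C) = Re z * c.
Proof. by rewrite ReMc mulr0 subr0. Qed.
Let ImMr (z : R[i]) (c : R) : Im (z * c%:C) = Im z * c.
Proof. by rewrite ImMc mulr0 add0r. Qed.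

Variable theta : R.
Local Notation u := (fun x => expi theta * (p x)%:C).
Local Notation v := (fun x => expi theta * (- drift x * p x)%:C).

Let ReU x : Re (u x) = cos theta * p x.
Proof. by rewrite ReMc /= mulr0 subr0. Qed.
Let ImU x : Im (u x) = sin theta * p x.
Proof. by rewrite ImMc /= mulr0 add0r. Qed.
Let ReV x : Re (v x) = cos theta * (- drift x * p x).
Proof. by rewrite ReMc /= mulr0 subr0. Qed.
Let ImV x : Im (v x) = sin theta * (- drift x * p x).
Proof. by rewrite ImMc /= mulr0 add0r. Qed.

Let ReUE : (fun x => Re (u x)) = (fun x => cos theta * p x).
Proof. by apply/funext => x; exact: ReU. Qed.
Let ImUE : (fun x => Im (u x)) = (fun x => sin theta * p x).
Proof. by apply/funext => x; exact: ImU. Qed.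
Let ReVE : (fun x => Re (v x)) = (fun x => cos theta * (- drift x * p x)).
Proof. by apply/funext => x; exact: ReV. Qed.
Let ImVE : (fun x => Im (v x)) = (fun x => sin theta * (- drift x * p x)).
Proof. by apply/funext => x; exact: ImV. Qed.

Let pu1 : primitive (fun x => Re (u x)) (fun x => Re (v x)).
Proof. by rewrite ReUE ReVE; apply: primitive_Z; exact: phi_primitive. Qed.
Let pu2 : primitive (fun x => Im (u x)) (fun x => Im (v x)).
Proof. by rewrite ImUE ImVE; apply: primitive_Z; exact: phi_primitive. Qed.

Lemma soliton_sqmod x : sqmod u x = p x ^+ 2.
Proof. by rewrite /sqmod ReU ImU !exprMn -mulrDl cos2Dsin2 mul1r. Qed.

Let vmeas : cmeasurable v.
Proof.
have mdp : measurable_fun setT (fun x => - drift x * p x).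
  apply: measurable_funM; last by apply: continuous_measurable_fun; exact: phi_continuous.
  by apply: measurableT_comp => //; exact: measurable_drift.
by split; rewrite ?ReVE ?ImVE; apply: measurable_funM.
Qed.

Let umeas : cmeasurable u.
Proof.
have cp := @phi_continuous _ gamma omega.
by split; rewrite ?ReUE ?ImUE; apply: continuous_measurable_fun;
  apply: continuous_fM => //; exact: continuous_fcst.
Qed.

Let uL2 : L2 u.
Proof.
apply: int_L2 => //; apply: intR_eq (phi2_int omega gamma0) => // x _.
by rewrite soliton_sqmod.
Qed.

Let vL2 : L2 v.
Proof.
apply: int_L2 => //.
have md := @measurable_drift _ gamma.
apply: intR_eq (poly_phi_int md drift_le) => // x _.
by rewrite /sqmod ReV ImV [(cos _ * _) ^+ 2]exprMn [(sin _ * _) ^+ 2]exprMn -mulrDl cos2Dsin2 mul1r mulNr sqrrN.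
Qed.

Let uv_weak : weak_derivative u v.
Proof.
move=> psi tpsi.
have E1 : \int[mu]_x Re (u x * (derive1 psi x)%:C) = - \int[mu]_x Re (v x * (psi x)%:C).
  under eq_Rintegral do rewrite ReMr.
  under [X in _ = - X]eq_Rintegral do rewrite ReMr.
  exact: primitive_weak pu1 tpsi.
have E2 : \int[mu]_x Im (u x * (derive1 psi x)%:C) = - \int[mu]_x Im (v x * (psi x)%:C).
  under eq_Rintegral do rewrite ImMr.
  under [X in _ = - X]eq_Rintegral do rewrite ImMr.
  exact: primitive_weak pu2 tpsi.
by rewrite /cintegral E1 E2.
Qed.

Lemma soliton_W : W u.
Proof.
have cp := @phi_continuous _ gamma omega.
split; [|split].
- by split; rewrite ?ReUE ?ImUE; apply: continuous_fM => //; exact: continuous_fcst.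
- by split => //; exists v.
- have i : intR setT (fun x => (omega + 1) * p x ^+ 2 - pot x * p x ^+ 2).
    apply: intR_B => //; last exact: pot_phi2_int.
    by apply: intR_Z => //; exact: phi2_int.
  apply: intR_eq i => // x _; rewrite sqlogE soliton_sqmod ln_phi_sqr; ring.
Qed.

(** Pairing a rotation of [phi] with h sees only H = cos theta Re h + sin theta Im h, so the complex
    equation reduces to the real one of [phi_weak_equation]. *)
Lemma soliton_stationary : stationary omega gamma u.
Proof.
move=> h Wh; have [ch [Hh _]] := Wh; have [Lh _] := Hh; have [Ldh wdh] := dxP Hh.
have [ph1 ph2] := weak_derivative_primitive ch Ldh wdh.
have [mh1 mh2 ih1 ih2] := L2_components Lh.
have [mk1 mk2 ik1 ik2] := L2_components Ldh.
have [cu [Hu _]] := soliton_W; have [Ldu wdu] := dxP Hu.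
have [pd1 pd2] := weak_derivative_primitive cu Ldu wdu.
have [md1 md2 _ _] := L2_components Ldu.
(* [dx] is an arbitrary choice among weak derivatives, so it agrees with the explicit one only
   almost everywhere. *)
have ae1 := primitive_ae_unique md1 vmeas.1 pd1 pu1.
have ae2 := primitive_ae_unique md2 vmeas.2 pd2 pu2.
pose H x := cos theta * Re (h x) + sin theta * Im (h x).
pose K x := cos theta * Re (dx h x) + sin theta * Im (dx h x).
have pHK : primitive H K by apply: primitive_D; exact: primitive_Z.
have mK : measurable_fun setT K by apply: measurable_funD; exact: measurable_funM.
have mH : measurable_fun setT H by apply: measurable_funD; exact: measurable_funM.
have sq (f g : R -> R) : measurable_fun setT f -> measurable_fun setT g ->
    intR setT (fun x => f x ^+ 2) -> intR setT (fun x => g x ^+ 2) ->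
    intR setT (fun x => (cos theta * f x + sin theta * g x) ^+ 2).
  move=> mf mg fi gi.
  have i := intR_D measurableT (intR_D measurableT (intR_Z (cos theta ^+ 2) measurableT fi)
    (intR_Z (2 * cos theta * sin theta) measurableT (intR_prod mf mg fi gi)))
    (intR_Z (sin theta ^+ 2) measurableT gi).
  by apply: intR_eq i => // x _; ring.
have iH : intR setT (fun x => H x ^+ 2) by exact: sq.
have iK : intR setT (fun x => K x ^+ 2) by exact: sq.
have WE := phi_weak_equation pHK mK iH iK.
have ReE z t w : Re (z + omega%:C * t - w) = Re z + omega * Re t - Re w :> R.
  by case: z t w => [? ?] [? ?] [? ?] /=; rewrite mul0r subr0.
have Rec (z t : R[i]) : Re (z * t^*) = Re z * Re t + Im z * Im t.
  by case: z t => [? ?] [? ?] /=; rewrite mulrN opprK.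
have Recint f : Re (cintegral f) = \int[mu]_x Re (f x) by [].
rewrite ReE !Recint Rec ReU ImU -[RHS]WE.
congr (_ + _ * _ - _ - _ * _).
- apply: Rint_ae_eq => //.
  + rewrite (_ : (fun x => _) = (fun x => Re (dx u x) * Re (dx h x) + Im (dx u x) * Im (dx h x))).
      by apply: measurable_funD; apply: measurable_funM.
    by apply/funext => x; rewrite Rec.
  + apply: measurable_funM => //; apply: measurable_funM.
      by apply: measurableT_comp => //; exact: measurable_drift.
    by apply: continuous_measurable_fun; exact: phi_continuous.
  apply: ae_imp (ae_and ae1 ae2) => x [e1 e2] _.
  by rewrite Rec e1 e2 ReV ImV /K; ring.
- by apply: eq_Rintegral => x _; rewrite Rec ReU ImU /H; ring.
- apply: eq_Rintegral => x _.
  rewrite normc_sqrE -/(sqmod u x) soliton_sqmod ln_phi_sqr Rec ReMr ImMr ReU ImU /H; ring.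
- by rewrite /H; ring.
Qed.

End Soliton.

(** * Value of the infimum and identification of the minimizers *)

Section Minimization.
Context {R : realType}.
Local Notation mu := (@lebesgue_measure R).
Local Notation Re := complex.Re.
Local Notation Im := complex.Im.
Variables gamma omega : R.
Hypothesis gamma0 : 0 < gamma.
Local Notation p := (phi omega gamma).
Local Notation mp := (\int[mu]_x (p x ^+ 2)).
Local Notation soliton theta := (fun x : R => expi theta * (p x)%:C).
Implicit Type u : R -> R[i].

(** Testing the equation with h = u gives the Nehari functional; the constraint on the profile thus
    follows without evaluating any Gaussian integral. *)
Lemma stationary_nehari u : W u -> stationary omega gamma u ->
  nehari omega gamma u = 0.
Proof.
move=> Wu /(_ u Wu) <-; rewrite nehariE//.
have ReE (z t w : R[i]) : Re (z + omega%:C * t - w) = Re z + omega * Re t - Re w.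
  by case: z t w => [? ?] [? ?] [? ?] /=; rewrite mul0r subr0.
have Rec (z t : R[i]) : Re (z * t^*) = Re z * Re t + Im z * Im t.
  by case: z t => [? ?] [? ?] /=; rewrite mulrN opprK.
have Recint f : Re (cintegral f) = \int[mu]_x Re (f x) by [].
rewrite ReE !Recint Rec -!expr2 -/(sqmod u 0) addrAC; congr (_ + _ * _ - _ - _).
- by apply: eq_Rintegral => x _; rewrite Rec -!expr2.
- by apply: eq_Rintegral => x _; rewrite Rec -!expr2.
- apply: eq_Rintegral => x _; rewrite Rec normc_sqrE -/(sqmod u x) ReMc ImMc /= /sqmod; ring.
Qed.

Lemma soliton_nehari theta : nehari omega gamma (soliton theta) = 0.
Proof.
by apply: stationary_nehari; [exact: soliton_W|exact: soliton_stationary].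
Qed.

Lemma soliton_action theta : action omega gamma (soliton theta) = 2^-1 * mp.
Proof.
rewrite actionE; last exact: soliton_W.
rewrite soliton_nehari mulr0 add0r; congr (_ * _).
by apply: eq_Rintegral => x _; rewrite soliton_sqmod.
Qed.

Lemma soliton_admissible theta : admissible omega gamma (soliton theta).
Proof.
split; first exact: soliton_W; split; last exact: soliton_nehari.
move=> /(congr1 (fun u => sqmod u 0)); rewrite soliton_sqmod /sqmod /= expr0n addr0.
by move/eqP; rewrite gt_eqF ?phi2_gt0.
Qed.

Lemma admissible_mass u : admissible omega gamma u -> mp <= \int[mu]_x sqmod u x.
Proof.
move=> [Wu [un0 Nu]]; have m0 := W_mass_gt0 Wu un0.
have := W_inequality omega gamma0 Wu un0; rewrite Nu pmulr_rle0// => h.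
have c0 : 0 < mp / \int[mu]_x sqmod u x by rewrite divr_gt0// phi_mass_gt0.
rewrite leNgt; apply/negP => lt.
have : 0 < ln (mp / \int[mu]_x sqmod u x) by rewrite ln_gt0// ltr_pdivlMr// mul1r.
by rewrite ltNge h.
Qed.

Lemma levelE : level gamma omega = (2^-1 * mp)%:E.
Proof.
apply/eqP; rewrite eq_le; apply/andP; split.
  apply: ereal_inf_lbound; exists (soliton 0); first exact: soliton_admissible.
  by rewrite soliton_action.
apply: le_ereal_inf_tmp => _ [u Au <-]; rewrite lee_fin.
have [Wu [_ Nu]] := Au; rewrite actionE// Nu mulr0 add0r ler_pM2l ?invr_gt0//.
exact: admissible_mass.
Qed.

Lemma minimizer_soliton u : minimizers omega gamma u ->
  exists theta, u = soliton theta.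
Proof.
move=> [Wu [+ Nu]]; rewrite levelE actionE// Nu mulr0 add0r => -[].
have h2 : 2^-1 != 0 :> R by rewrite invr_eq0 pnatr_eq0.
move=> /(mulfI h2) meq.
(* [minimizers] does not exclude 0 by definition, but 0 has mass 0 whereas the mass of a minimizer
   is that of [phi], which is positive. *)
have un0 : u <> (fun=> 0).
  move=> u0; have := phi_mass_gt0 omega gamma0; rewrite -meq u0.
  under eq_Rintegral do rewrite /sqmod /= expr0n addr0.
  by rewrite /Rintegral integral0 ltxx.
have [[a b] /= ab uE] := W_rigidity gamma0 Wu un0 Nu meq.
have [th thE] := expi_surj ab.
by exists th; apply/funext => x; rewrite uE thE.
Qed.

End Minimization.

Theorem theorem4p4 (R : realType) (gamma omega : R) (gamma_gt0 : 0 < gamma) :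
  (exists u : R -> R[i], admissible omega gamma u /\
     (action omega gamma u)%:E = level gamma omega) /\
  (forall u : R -> R[i], minimizers omega gamma u -> stationary omega gamma u) /\
  minimizers omega gamma =
    [set u : R -> R[i] | exists theta : R,
       u = (fun x => expi theta * (phi omega gamma x)%:C)].
Proof.
split; [|split].
- exists (fun x => expi 0 * (phi omega gamma x)%:C).
  by rewrite levelE// soliton_action//; split => //; exact: soliton_admissible.
- move=> u /(minimizer_soliton gamma_gt0)[th ->].
  exact: soliton_stationary.
apply/seteqP; split=> [u|u [th ->]]; first exact: minimizer_soliton.
split; first exact: soliton_W.
by rewrite levelE// soliton_action// soliton_nehari.
Qed.
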